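(* Let $\mathcal S^{-1}\mathrm{As}$ be the nonsymmetric (ns) operad of shifted associative algebras, identified with the ns suboperad of $\mathrm{ncGerst}$ generated by the connected bamboo $b$ with two vertices, and let $$\mathcal S^{-1}\mathrm{As}^+:=\frac{\mathcal S^{-1}\mathrm{As}\,\widehat\vee\,\gamma}{\big(b(\gamma,-),\ b(-,\gamma)\big)},$$ where $\gamma$ is an arity $0$, degree $-4$ element placed in $\mathrm F_1$. The map of complete dg ns operads $\mathcal S^{-1}\mathrm{As}\,\widehat\vee\,\gamma\to\mathrm{Tw}\,\mathrm{ncGerst}$ defined by sending $b$ to $b$ (the connected bamboo with two white vertices) and $\gamma$ to the graph consisting of two disjoint black vertices (with no edge) induces an isomorphism of complete ns operads $$H_\bullet(\mathrm{Tw}\,\mathrm{ncGerst})\cong\mathcal S^{-1}\mathrm{As}^+ .$$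
   Context: The ns operad $\mathrm{ncGerst}$: $\mathrm{ncGerst}(0)=0$; for $n\ge1$, $\mathrm{ncGerst}(n)$ has as basis the bamboos, i.e. the graphs with vertices $1,\dots,n$ ordered from left to right whose edges form a subset of $\{(1,2),(2,3),\dots,(n-1,n)\}$. Each edge has homological degree $1$; edges are ordered from left to right and reordering produces the sign of the permutation. The composite $\Gamma_1\circ_i\Gamma_2$ ($\Gamma_2$ with $k$ vertices) places $\Gamma_2$ at vertex $i$ of $\Gamma_1$ and relabels; the edge $(i-1,i)$ (resp. $(i+k-1,i+k)$) is present iff $(i-1,i)$ (resp. $(i,i+1)$) is an edge of $\Gamma_1$; the sign is that obtained by reordering (edges of $\Gamma_1$ followed by edges of $\Gamma_2$) from left to right. Let $b\in\mathrm{ncGerst}(2)$ be the bamboo with the edge $(1,2)$; $b\circ_1b=-b\circ_2b$. Twisting: $\mathrm{ncGerst}$ carries the shifted multiplicative structure $\mathcal S^{-1}\mathcal A_\infty\to\mathcal S^{-1}\mathrm{As}\to\mathrm{ncGerst}$, $\mu_2\mapsto b$, $\mu_n\mapsto0$ for $n\ge3$. Let $\alpha$ be an element of arity $0$ and degree $-2$ (filtration degree $1$). $\mathrm{Tw}\,\mathrm{ncGerst}$ is the complete ns operad $\mathrm{ncGerst}\,\widehat\vee\,\alpha$ (completed coproduct of ns operads with the operad spanned by $\alpha$), whose elements are series, indexed by $k\ge0$, of elements of $\mathrm{ncGerst}$ with $k$ copies of $\alpha$ plugged in, with the differential which is the derivation characterised by $\mathrm d(\alpha)=b(\alpha,\alpha)$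 and $\mathrm d(\nu)=\mu_1^\alpha\star\nu-(-1)^{|\nu|}\nu\star\mu_1^\alpha$ for $\nu\in\mathrm{ncGerst}$, where $\mu_1^\alpha=b(\alpha,-)+b(-,\alpha)$ and $\nu\star\mu=\sum_i\nu\circ_i\mu$. Graphically: bamboos with white vertices labelled from left to right (inputs) and black vertices (copies of $\alpha$), each black vertex having degree $-2$ and each edge degree $1$; the filtration is by the number of black vertices. $\mathcal S^{-1}\mathrm{As}\,\widehat\vee\,\gamma$ is the completed coproduct of ns operads with the operad spanned by $\gamma$; it has zero differential.
   Formalization: ''Isomorphism of complete ns operads'' is read as a bijective filtered morphism with continuous inverse: the inverse cannot preserve the filtrations strictly, since γ is in F_1 but not in F_2 while its image, the class of two black vertices, lies in F_2. *)

(* Defs.v *)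
From HB Require Import structures.
From mathcomp Require Import all_boot all_order all_algebra.
From mathcomp Require Import generic_quotient ring_quotient.
From mathcomp Require Import boolp classical_sets.
Import GRing.Theory.

Set Implicit Arguments.
Unset Strict Implicit.
Unset Printing Implicit Defensive.

Local Open Scope ring_scope.
Local Open Scope quotient_scope.

(* Infinite products over [nat]. *)
Definition series (T : nat -> Type) : Type := forall k, T k.

Section Series.
Variables (K : fieldType) (V : nat -> lmodType K).
Implicit Types f g h : series V.

HB.instance Definition _ := gen_eqMixin (series V).
HB.instance Definition _ := gen_choiceMixin (series V).

Definition series_zero : series V := fun=> 0.
Definition series_opp f : series V := fun k => - f k.
Definition series_add f g : series V := fun k => f k + g k.
Definition series_scale (a : K) f : series V := fun k => a *: f k.

Fact series_addA : associative series_add.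
Proof. by move=> f g h; apply: functional_extensionality_dep => k; apply: addrA. Qed.
Fact series_addC : commutative series_add.
Proof. by move=> f g; apply: functional_extensionality_dep => k; apply: addrC. Qed.
Fact series_add0 : left_id series_zero series_add.
Proof. by move=> f; apply: functional_extensionality_dep => k; apply: add0r. Qed.
Fact series_addN : left_inverse series_zero series_opp series_add.
Proof. by move=> f; apply: functional_extensionality_dep => k; apply: addNr. Qed.
HB.instance Definition _ :=
  GRing.isZmodule.Build (series V) series_addA series_addC series_add0 series_addN.

Fact series_scaleA a b f :
  series_scale a (series_scale b f) = series_scale (a * b) f.
Proof. by apply: functional_extensionality_dep => k; apply: scalerA. Qed.
Fact series_scale1 : left_id 1 series_scale.
Proof. by move=> f; apply: functional_extensionality_dep => k; apply: scale1r. Qed.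
Fact series_scaleDr : right_distributive series_scale +%R.
Proof. by move=> a f g; apply: functional_extensionality_dep => k; apply: scalerDr. Qed.
Fact series_scaleDl f :
  {morph series_scale^~ f : a b / a + b}.
Proof. by move=> a b; apply: functional_extensionality_dep => k; apply: scalerDl. Qed.
HB.instance Definition _ := GRing.Zmodule_isLmodule.Build K (series V)
  series_scaleA series_scale1 series_scaleDr series_scaleDl.
End Series.

Record submodule (K : fieldType) (V : lmodType K) :=
  Submodule { smem :> {pred V}; smemP : submod_closed smem }.

HB.instance Definition _ (K : fieldType) (V : lmodType K) (S : submodule V) :=
  GRing.isSubmodClosed.Build K V (smem S) (smemP S).

Section SubmoduleQuotient.
Variables (K : fieldType) (V : lmodType K) (S : submodule V).

Record submod := Submod { submod_val :> V; _ : submod_val \in smem S }.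
HB.instance Definition _ := [isSub for submod_val].
HB.instance Definition _ := [Choice of submod by <:].
HB.instance Definition _ := [SubChoice_isSubZmodule of submod by <:].
HB.instance Definition _ := [SubZmodule_isSubLmodule of submod by <:].

Definition quotmod : Type := Quotient.quot (smem S : zmodClosed V).
HB.instance Definition _ := GRing.Zmodule.on quotmod.

Definition quotpi (x : V) : quotmod := \pi_(Quotient.quot (smem S : zmodClosed V)) x.
Definition quotrepr (x : quotmod) : V := repr (x : Quotient.quot (smem S : zmodClosed V)).

Lemma quotreprK : cancel quotrepr quotpi.
Proof. exact: reprK. Qed.
Lemma quotpiE x y : (quotpi x == quotpi y) = (x - y \in smem S).
Proof. by rewrite /quotpi -Quotient.idealrBE. Qed.
Lemma quotpiD : {morph quotpi : x y / x + y}.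
Proof. exact: Quotient.pi_add. Qed.

Definition quot_scale (a : K) (x : quotmod) : quotmod := quotpi (a *: quotrepr x).

Lemma quotpiZ a x : quotpi (a *: x) = quot_scale a (quotpi x).
Proof.
apply/eqP; rewrite quotpiE -scalerBr rpredZ // -quotpiE.
by rewrite quotreprK.
Qed.

Fact quot_scaleA a b x : quot_scale a (quot_scale b x) = quot_scale (a * b) x.
Proof. by rewrite -[x]quotreprK -!quotpiZ scalerA. Qed.
Fact quot_scale1 : left_id 1 quot_scale.
Proof. by move=> x; rewrite -[x]quotreprK -quotpiZ scale1r. Qed.
Fact quot_scaleDr : right_distributive quot_scale +%R.
Proof.
move=> a x y; rewrite -[x]quotreprK -[y]quotreprK.
by rewrite -quotpiD -!quotpiZ -quotpiD scalerDr.
Qed.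
Fact quot_scaleDl x : {morph quot_scale^~ x : a b / a + b}.
Proof. by move=> a b; rewrite -[x]quotreprK -!quotpiZ -quotpiD scalerDl. Qed.
HB.instance Definition _ := GRing.Zmodule_isLmodule.Build K quotmod
  quot_scaleA quot_scale1 quot_scaleDr quot_scaleDl.

Fact quotpi_is_linear : linear quotpi.
Proof. by move=> a x y; rewrite quotpiD quotpiZ. Qed.
HB.instance Definition _ :=
  GRing.isLinear.Build K V quotmod _ quotpi quotpi_is_linear.
End SubmoduleQuotient.

(* The structure maps only.  [P n d] is the component of arity [n] and
   homological degree [d]; [ocomp i x y] is the partial composite at the input
   of [x] of index [i], inputs being numbered from 0, and it is meaningful only
   for [i < m].  [ofilt p] is the [p]-th term of the decreasing filtration. *)
Record ns_operad (K : fieldType) := NsOperad {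
  ohom :> nat -> int -> lmodType K;
  ounit : ohom 1%N 0;
  ocomp : forall m n p q,
    nat -> ohom m p -> ohom n q -> ohom (m + n).-1%N (p + q);
  ofilt : nat -> forall n d, set (ohom n d)
}.

(* Transport along equalities of arities and of degrees; 0 when they fail. *)
Definition recast (K : fieldType) (P : ns_operad K) m p n q (x : P m p) : P n q :=
  match m =P n, p =P q with
  | ReflectT emn, ReflectT epq =>
      eq_rect p (P n) (eq_rect m (fun j => P j p) x n emn) q epq
  | _, _ => 0
  end.
Arguments recast {K P m p n q} x.

Section Recast.
Variables (K : fieldType) (P : ns_operad K) (m n : nat) (p q : int).

Lemma recast0 : recast (0 : P m p) = 0 :> P n q.
Proof. by rewrite /recast; case: eqP => // e; case: eqP => // e'; subst. Qed.

Lemma recastP (a : K) (x y : P m p) :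
  recast (a *: x + y) = a *: recast x + recast y :> P n q.
Proof.
rewrite /recast; case: eqP => [e|_]; last by rewrite scaler0 addr0.
by case: eqP => [e'|_]; [subst | rewrite scaler0 addr0].
Qed.
End Recast.

Section Morphisms.
Variables (K : fieldType) (P Q : ns_operad K).
Implicit Type phi : forall n d, {linear P n d -> Q n d}.

Record is_morphism phi : Prop := IsMorphism {
  morph_unit : phi _ _ (ounit P) = ounit Q;
  morph_comp : forall m n p q i (x : P m p) (y : P n q), (i < m)%N ->
    phi _ _ (ocomp i x y) = ocomp i (phi _ _ x) (phi _ _ y);
  morph_filt : forall p n d (x : P n d), ofilt p x -> ofilt p (phi _ _ x)
}.

(* The last clause says that the inverse is continuous for the topologies
   defined by the filtrations. One cannot ask for [q = p] when comparing
   [shAs_plus] with the homology of [Tw]: [gamma] only lies in the first term of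
   the filtration, but its image has a representative with two black vertices. *)
Record is_isomorphism phi : Prop := IsIsomorphism {
  iso_morph : is_morphism phi;
  iso_bij : forall n d, bijective (phi n d);
  iso_filt : forall p, exists q, forall n d (x : P n d),
    ofilt q (phi _ _ x) -> ofilt p x
}.
End Morphisms.

Definition is_derivation (K : fieldType) (P : ns_operad K)
    (D : forall n d, {linear P n d -> P n (d - 1)}) : Prop :=
  (forall m n p q i (x : P m p) (y : P n q), (i < m)%N ->
     D _ _ (ocomp i x y) =
       recast (ocomp i (D _ _ x) y)
       + (-1) ^+ `|p|%N *: recast (ocomp i x (D _ _ y)))
  /\ (forall p n d (x : P n d), ofilt p x -> ofilt p (D _ _ x)).

Section SubQuotient.
Variables (K : fieldType) (P : ns_operad K).

(* When [S] contains the unit and is closed under composition, the operations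
   of [P] restrict to [S], and [insubd 0] below is never used on an element
   outside of [S]. *)
Definition sub_operad (S : forall n d, submodule (P n d)) : ns_operad K :=
  @NsOperad K (fun n d => submod (S n d))
    (insubd 0 (ounit P))
    (fun m n p q i x y => insubd 0 (ocomp i (\val x) (\val y)))
    (fun p n d x => ofilt p (\val x)).

(* For an ideal [I] the composite does not depend on the representatives. *)
Definition quot_operad (I : forall n d, submodule (P n d)) : ns_operad K :=
  @NsOperad K (fun n d => quotmod (I n d))
    (quotpi _ (ounit P))
    (fun m n p q i x y => quotpi _ (ocomp i (quotrepr x) (quotrepr y)))
    (fun p n d x => exists2 y, ofilt p y & quotpi _ y = x).

Definition is_suboperad (S : forall n d, {pred P n d}) : Prop :=
  [/\ forall n d, submod_closed (S n d),
      ounit P \in S _ _ &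
      forall m n p q i (x : P m p) (y : P n q), (i < m)%N ->
        x \in S _ _ -> y \in S _ _ -> ocomp i x y \in S _ _].

Definition suboperad_mem (G : forall n d, set (P n d)) n d : {pred P n d} :=
  fun x => `[< forall S, is_suboperad S ->
                 (forall n' d' (y : P n' d'), G _ _ y -> y \in S _ _) ->
                 x \in S _ _ >].

Fact suboperad_mem_closed G n d : submod_closed (@suboperad_mem G n d).
Proof.
split; first by apply/asboolP => S [cS _ _] _; case: (cS n d).
move=> a x y /asboolP Sx /asboolP Sy; apply/asboolP => S oS GS.
by case: (oS) => cS _ _; apply: (cS n d).2; [apply: Sx | apply: Sy].
Qed.

Definition generated_suboperad G n d : submodule (P n d) :=
  Submodule (@suboperad_mem_closed G n d).

(* Ideals are closed for the topology of the filtration, so that the quotient is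
   the one in complete operads. *)
Definition is_ideal (I : forall n d, {pred P n d}) : Prop :=
  [/\ forall n d, submod_closed (I n d),
      forall m n p q i (x : P m p) (y : P n q), (i < m)%N ->
        x \in I _ _ -> ocomp i x y \in I _ _,
      forall m n p q i (x : P m p) (y : P n q), (i < m)%N ->
        y \in I _ _ -> ocomp i x y \in I _ _ &
      forall n d (x : P n d),
        (forall p, exists2 y, y \in I n d & ofilt p (x - y)) -> x \in I n d].

Definition ideal_mem (G : forall n d, set (P n d)) n d : {pred P n d} :=
  fun x => `[< forall I, is_ideal I ->
                 (forall n' d' (y : P n' d'), G _ _ y -> y \in I _ _) ->
                 x \in I _ _ >].

Fact ideal_mem_closed G n d : submod_closed (@ideal_mem G n d).
Proof.
split; first by apply/asboolP => I [cI _ _ _] _; case: (cI n d).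
move=> a x y /asboolP Ix /asboolP Iy; apply/asboolP => I iI GI.
by case: (iI) => cI _ _ _; apply: (cI n d).2; [apply: Ix | apply: Iy].
Qed.

Definition generated_ideal G n d : submodule (P n d) :=
  Submodule (@ideal_mem_closed G n d).

End SubQuotient.

Section Homology.
Variables (K : fieldType) (P : ns_operad K).
Variable D : forall n d, {linear P n d -> P n (d - 1)}.

Fact cycles_closed n d : submod_closed [pred x : P n d | D n d x == 0].
Proof.
split; first by rewrite inE raddf0.
by move=> a x y /eqP Dx /eqP Dy; rewrite inE linearP Dx Dy scaler0 addr0.
Qed.
Definition cycles n d := Submodule (@cycles_closed n d).

Fact boundaries_closed n d : submod_closed
  [pred z : sub_operad cycles n d |
     `[< exists y : P n (d + 1), recast (D n (d + 1) y) = \val z >]].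
Proof.
split=> [|a u v /asboolP[x xu] /asboolP[y yv]]; apply/asboolP.
  by exists 0; rewrite linear0 recast0.
by exists (a *: x + y); rewrite linearP recastP xu yv.
Qed.
Definition boundaries n d := Submodule (@boundaries_closed n d).

Definition homology : ns_operad K := quot_operad boundaries.

(* Meaningful only when [x] is a cycle. *)
Definition hclass n d (x : P n d) : homology n d :=
  quotpi (boundaries n d) (insubd 0 x).
End Homology.

(* Words of length [n + k] with [k] letters [true]: the inputs of an operation
   of arity [n + k] which receive a copy of the arity 0 element are marked by
   [true], the other ones are the inputs of the result. *)
Definition word n k : predArgType :=
  {w : (n + k).-tuple bool | count id w == k}.

(* Position of the [i]-th [false] of [u]. *)
Definition input_pos i (u : seq bool) : nat :=
  nth (size u) [seq j <- iota 0 (size u) | ~~ nth true u j] i.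

Definition graft_word i (u v : seq bool) : seq bool :=
  take (input_pos i u) u ++ v ++ drop (input_pos i u).+1 u.

Section Coproduct.
Variables (K : fieldType) (P : ns_operad K) (c : nat).

(* The arity 0 element has degree [- 2c] and filtration degree 1.  Its degree
   being even, no sign arises from moving copies of it. *)
Definition coprod_hom n d : lmodType K :=
  series (fun k => {ffun word n k -> P (n + k)%N (d + (k * c.*2)%N%:Z)}).

Definition coprod_incl n d (x : P n d) : coprod_hom n d :=
  fun k => [ffun=> recast x].

Definition coprod_elt : coprod_hom 0%N (- (c.*2)%:Z) :=
  fun k => [ffun=> recast (ounit P)].

Definition coprod_comp m n p q i (x : coprod_hom m p) (y : coprod_hom n q) :
    coprod_hom (m + n).-1%N (p + q) :=
  fun k => \sum_(j < k.+1) [ffun w : word (m + n).-1 k =>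
    \sum_(u : word m j)
      \sum_(v : word n (k - j)%N | graft_word i (\val u) (\val v) == \val w)
        recast (ocomp (input_pos i (\val u)) (x j u) (y (k - j)%N v))].

Definition coprod : ns_operad K :=
  @NsOperad K coprod_hom (coprod_incl (ounit P)) coprod_comp
    (fun p n d x => forall k (w : word n k), ofilt (p - k)%N (x k w)).
End Coproduct.

(* The [j]-th entry tells whether there is an edge between the vertices [j] and
   [j + 1], vertices being numbered from 0. *)
Definition bamboo n (d : int) : predArgType :=
  {e : n.-1.-tuple bool | (0 < n)%N && ((count id e)%:Z == d)}.

Definition graft_edges i (e1 e2 : seq bool) : seq bool :=
  take i e1 ++ e2 ++ drop i e1.

(* Reordering "edges of e1, then edges of e2" moves the edges of e2 across the
   edges of e1 lying on the right of the vertex [i]. *)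
Definition graft_sign (K : fieldType) i (e1 e2 : seq bool) : K :=
  (-1) ^+ (count id (drop i e1) * count id e2).

Section NcGerst.
Variable K : fieldType.

Definition ncGerst_hom n d : lmodType K := {ffun bamboo n d -> K^o}.

Definition ncGerst_comp m n p q i (f : ncGerst_hom m p) (g : ncGerst_hom n q) :
    ncGerst_hom (m + n).-1%N (p + q) :=
  [ffun e : bamboo (m + n).-1 (p + q) =>
    \sum_(e1 : bamboo m p)
      \sum_(e2 : bamboo n q | graft_edges i (\val e1) (\val e2) == \val e)
        graft_sign K i (\val e1) (\val e2) * f e1 * g e2].

Definition ncGerst : ns_operad K :=
  @NsOperad K ncGerst_hom [ffun=> 1] ncGerst_comp
    (fun p n d x => p = 0%N \/ x = 0).

(* There is exactly one bamboo with 2 vertices in degree 1, and one in degree 0. *)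
Definition edge : ncGerst 2%N 1 := [ffun=> 1].
Definition noedge : ncGerst 2%N 0 := [ffun=> 1].

Definition Tw : ns_operad K := coprod ncGerst 1.

Definition Tw_incl n d (x : ncGerst n d) : Tw n d := coprod_incl 1 x.
Definition alpha : Tw 0%N (- 2%:Z) := coprod_elt ncGerst 1.
Definition Tw_edge : Tw 2%N 1 := Tw_incl edge.

Definition edge_alpha_alpha : Tw 0%N (-3) :=
  recast (ocomp 0 (ocomp 0 Tw_edge alpha) alpha).

Definition mu1 : Tw 1%N (-1) :=
  recast (ocomp 0 Tw_edge alpha) + recast (ocomp 1 Tw_edge alpha).

Definition alpha_alpha : Tw 0%N (-4) :=
  recast (ocomp 0 (ocomp 0 (Tw_incl noedge) alpha) alpha).

Definition is_twisting_differential
    (D : forall n d, {linear Tw n d -> Tw n (d - 1)}) : Prop :=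
  [/\ is_derivation D,
      D _ _ alpha = recast edge_alpha_alpha,
      forall m p (nu : ncGerst m p),
        D _ _ (Tw_incl nu) =
          recast (ocomp 0 mu1 (Tw_incl nu))
          - (-1) ^+ `|p|%N *: \sum_(i < m) recast (ocomp i (Tw_incl nu) mu1) &
      forall n d (x : Tw n d), D _ _ (D _ _ x) = 0].

Inductive is_edge : forall n d, ncGerst n d -> Prop :=
  IsEdge : is_edge edge.

Definition shAs_sub := generated_suboperad is_edge.

Definition shAs : ns_operad K := sub_operad shAs_sub.
Definition shAs_edge : shAs 2%N 1 := insubd 0 edge.

Definition shAs_gamma : ns_operad K := coprod shAs 2.
Definition gamma : shAs_gamma 0%N (- 4%:Z) := coprod_elt shAs 2.
Definition shAs_gamma_edge : shAs_gamma 2%N 1 := coprod_incl 2 shAs_edge.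

Inductive shAs_plus_relation : forall n d, shAs_gamma n d -> Prop :=
  | EdgeGammaL : shAs_plus_relation (ocomp 0 shAs_gamma_edge gamma)
  | EdgeGammaR : shAs_plus_relation (ocomp 1 shAs_gamma_edge gamma).

Definition shAs_plus_ideal := generated_ideal shAs_plus_relation.

Definition shAs_plus : ns_operad K := quot_operad shAs_plus_ideal.

(* The morphism of complete dg operads from [shAs_gamma], which has zero
   differential, given by the images of the generators. *)
Record is_comparison (D : forall n d, {linear Tw n d -> Tw n (d - 1)})
    (phi : forall n d, {linear shAs_gamma n d -> Tw n d}) : Prop := IsComparison {
  comparison_morph : is_morphism phi;
  comparison_dg : forall n d x, D n d (phi n d x) = 0;
  comparison_edge : phi _ _ shAs_gamma_edge = Tw_edge;
  comparison_gamma : phi _ _ gamma = alpha_alpha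
}.
End NcGerst.

(* Main.v *)
Require Import Defs.
From HB Require Import structures.
From mathcomp Require Import all_boot all_order all_algebra.
From mathcomp Require Import generic_quotient boolp classical_sets zify ring.
Import GRing.Theory.
Set Implicit Arguments.
Unset Strict Implicit.
Unset Printing Implicit Defensive.

Local Open Scope ring_scope.

(** Reading a bamboo from left to right turns it into a word in three letters:
    [x] for an input, [a] for a copy of the arity 0 element, and [s] for a place
    between two neighbouring vertices where there is no edge.  The words that
    occur are the nonempty ones that neither begin nor end with [s] and have no
    two consecutive [s].  Letter counts determine arity and degree, only finitely
    many words share a given arity and degree, and so the infinite products of
    the completed coproduct are spanned by words in each bidegree ([lin_ext_id]).
    Signs are governed by lengths: plugging [v] into the input [x] of [w0 x w1]
    gives [(-1)^(|w1| (|v| - 1)) w0 v w1] ([comp_B]).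

    In this language the twisting differential is the Koszul derivation
    [a -> aa], [s -> as + sa], [x -> 0] ([wdiff]).  The reason is that [mu1] acts
    on words without [a] by the inner derivation [ [a, -] ], whose values on the
    letters [x] are exactly the terms [nu o_i mu1] that are subtracted
    ([wdiff_insert_blk], [twD_incl]).  Every word comes from words without [a] by
    plugging in [alpha], whence uniqueness ([twD_unique]).  In the same way the
    comparison map sends [x] to [x] and [gamma] to [a s a], and it is determined
    by its values on generators ([phi_unique]).

    The differential moves neither the letters [x] nor the letters [s], so the
    complex is a sum, over the words in [x] and [s], of tensor products of
    complexes spanned by the runs [a^k] between these letters.  A run [a^k] with
    [t] neighbours [s] is sent to plus or minus [a^(k+1)] if [k + t] is odd, and to
    0 otherwise.  The empty run is allowed except between two [s], between an end
    of the word and an [s], and as the whole word.  This leaves homology in two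
    cases only: the empty run when [t = 0], and the single [a] at an end of the
    word when [t = 1].  A run between [s] and [x] is acyclic, hence what survives
    is [x ... x] in positive arity and [a s a] in arity 0.  An explicit contraction of
    the first run that is not in its surviving state makes this precise
    ([contract_homotopy], [cycle_homotopy]).

    On the other side, a word in [x] and [gamma] of length at least 2 that
    contains [gamma] is a composite of [b(gamma, -)] or [b(-, gamma)]
    ([plugged_in_ideal]), so that the quotient is also spanned by the words
    [x ... x] and [gamma].  The general statement [induced_isomorphism] about maps
    onto homology that admit a retraction concludes. *)

(** * Bamboos as words *)

(** The two vertex letters are [Some c], where [c] is the colour used by [word];
    thus words of colours are mapped into words of letters by [Some]. *)
Definition letter : Type := option bool.
Notation inp := (Some false : letter) (only parsing).
Notation blk := (Some true : letter) (only parsing).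
Notation gap := (None : letter) (only parsing).

Definition num_inp (w : seq letter) := count_mem inp w.
Definition num_blk (w : seq letter) := count_mem blk w.
Definition num_gap (w : seq letter) := count_mem gap w.

Definition no_two_gaps (p q : letter) := isSome p || isSome q.

(** Padding the word with a gap on each side expresses by a single condition that
    it is nonempty, that its ends are vertices and that gaps are isolated. *)
Definition valid (w : seq letter) := path no_two_gaps gap (rcons w gap).

Definition tail_word (u e : seq bool) : seq letter :=
  flatten [seq if p.1 then [:: Some p.2] else [:: gap; Some p.2] | p <- zip e u].

Definition head_word (u e : seq bool) : seq letter :=
  flatten [seq if p.1 then [:: Some p.2] else [:: Some p.2; gap] | p <- zip e u].

Definition encode (u e : seq bool) : seq letter :=
  if u is c :: u' then Some c :: tail_word u' e else [::].

Lemma path_some b c s :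
  path no_two_gaps (Some b) s = path no_two_gaps (Some c) s.
Proof. by case: s. Qed.

Lemma path_tail_word c u e : path no_two_gaps (Some c) (rcons (tail_word u e) gap).
Proof.
elim: u c e => [|d u IH] c [|[] e] //=; rewrite /tail_word /=.
- by rewrite (IH d e).
- by rewrite (IH d e).
Qed.

Lemma encode_valid u e : u != [::] -> valid (encode u e).
Proof. by case: u => [//|c u] _; rewrite /valid /= path_tail_word. Qed.

Lemma tail_wordP c w : path no_two_gaps (Some c) (rcons w gap) ->
  exists u e, size e = size u /\ w = tail_word u e.
Proof.
have [n] := ubnP (size w); elim: n c w => // n IH c [|[d|] w] /= ltn pw.
- by exists [::], [::].
- have [//|u [e [se ->]]] := IH d w _ pw.
  by exists (d :: u), (true :: e); rewrite /= se.
- case: w ltn pw => [//|[d|//] w] /= ltn pw.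
  have [|u [e [se ->]]] := IH d w _ pw; first exact: ltnW.
  by exists (d :: u), (false :: e); rewrite /= se.
Qed.

Lemma validP w : valid w ->
  exists u e : seq bool, [/\ u != [::], size e = (size u).-1 & w = encode u e].
Proof.
case: w => [//|[c|//] w] /= /tail_wordP[u [e [se ->]]].
by exists (c :: u), e.
Qed.

Lemma tail_word_inj u e u' e' : size e = size u -> size e' = size u' ->
  tail_word u e = tail_word u' e' -> u = u' /\ e = e'.
Proof.
elim: u e u' e' => [|c u IH] [|b e] // [|c' u'] [|b' e'] //= se se'.
- by rewrite /tail_word /=; case: b'.
- by rewrite /tail_word /=; case: b.
rewrite /tail_word /=; case: b; case: b' => //= -[->] E;
  by have [|| -> ->] := IH _ _ _ _ _ E; [case: se | case: se' |].
Qed.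

Lemma encode_inj u e u' e' : size e = (size u).-1 -> size e' = (size u').-1 ->
  encode u e = encode u' e' -> u = u' /\ e = e'.
Proof.
case: u u' => [|c u] [|c' u'] //=; first by move=> /size0nil-> /size0nil->.
by move=> se se' [-> /tail_word_inj[]] // -> ->.
Qed.

Lemma num_tail_word u e : size e = size u ->
  [/\ num_inp (tail_word u e) = count negb u,
      num_blk (tail_word u e) = count id u,
      num_gap (tail_word u e) = count negb e &
      size (tail_word u e) = (size u + count negb e)%N].
Proof.
elim: u e => [|c u IH] [|b e] //= [/IH[]]; rewrite /num_inp /num_blk /num_gap.
by rewrite /tail_word; case: b; case: c => /= -> -> -> ->; split; lia.
Qed.

Lemma num_encode u e : u != [::] -> size e = (size u).-1 ->
  [/\ num_inp (encode u e) = count negb u,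
      num_blk (encode u e) = count id u,
      num_gap (encode u e) = count negb e &
      size (encode u e) = (size u + count negb e)%N].
Proof.
case: u => [//|c u] _ /= /num_tail_word[]; rewrite /num_inp /num_blk /num_gap.
by case: c => /= -> -> -> ->; split; lia.
Qed.

Lemma encode_head_cat u0 e0 v e : size e0 = size u0 -> v != [::] ->
  encode (u0 ++ v) (e0 ++ e) = head_word u0 e0 ++ encode v e.
Proof.
elim: u0 e0 => [|c u0 IH] [|b e0] // [s0] v0.
rewrite /head_word /= -/(head_word u0 e0) -catA -IH //.
have: u0 ++ v != [::] by case: (u0) v0.
by case: (u0 ++ v) => // d z _; case: b.
Qed.

Lemma encode_tail_cat v e u1 e1 : size e = (size v).-1 -> v != [::] ->
  encode (v ++ u1) (e ++ e1) = encode v e ++ tail_word u1 e1.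
Proof.
case: v => [//|c v] /= se _; rewrite /tail_word zip_cat //.
by rewrite map_cat flatten_cat.
Qed.

Lemma num_head_word u e : size e = size u -> num_inp (head_word u e) = count negb u.
Proof.
elim: u e => [|c u IH] [|b e] //= [/IH]; rewrite /num_inp.
by rewrite /head_word; case: b; case: c => /= ->.
Qed.

Lemma input_pos_cons i c u : (i < count negb (c :: u))%N ->
  input_pos i (c :: u) =
    if c then (input_pos i u).+1 else if i is j.+1 then (input_pos j u).+1 else 0%N.
Proof.
rewrite /input_pos /= (iotaDl 1 0) filter_map.
have E : forall j, (j < count negb u)%N ->
  nth (size u).+1 [seq (1 + x)%N | x <- [seq j <- iota 0 (size u) | ~~ nth true u j]] j =
  (nth (size u) [seq j <- iota 0 (size u) | ~~ nth true u j] j).+1.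
  move=> j ltj; rewrite (nth_map (size u)) // size_filter.
  rewrite -(count_map (nth true u)) //.
  have -> : [seq nth true u j | j <- iota 0 (size u)] = u.
    by apply: (@eq_from_nth _ true); rewrite ?size_map ?size_iota // => k kl;
       rewrite (nth_map 0%N) ?size_iota // nth_iota.
  exact: ltj.
case: c => /= [lti|]; first exact: E.
by case: i => [|i] //= lti; exact: E.
Qed.

(** Splitting at the chosen input replaces computations with positions by
    computations with concatenations. *)
Lemma input_posP i u : (i < count negb u)%N ->
  exists u0 u1, [/\ u = u0 ++ false :: u1, count negb u0 = i & input_pos i u = size u0].
Proof.
elim: u i => [//|c u IH] i lti; rewrite input_pos_cons //.
case: c lti => /= lti.
  by have [u0 [u1 [-> <- ->]]] := IH _ lti; exists (true :: u0), u1.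
case: i lti => [|i] lti; first by exists [::], u.
have [u0 [u1 [-> <- ->]]] := IH _ lti; by exists (false :: u0), u1.
Qed.

Lemma odd_count_negb e : odd (size e + count negb e) = odd (count id e).
Proof. by elim: e => //= -[] e; rewrite /= ?addnS ?addSn ?add0n /= ?negbK => ->. Qed.

Lemma odd_encode u e : u != [::] -> size e = (size u).-1 ->
  odd (size (encode u e)).-1 = odd (count id e).
Proof.
move=> u0 se; have [_ _ _ ->] := num_encode u0 se.
by rewrite -odd_count_negb se; case: u u0 se.
Qed.

(** Grafting of colours and grafting of edges together amount to a substitution
    of words.  The parity clause identifies the exponent of [graft_sign]: right of
    the input there are as many vertices as places, so that the edges there and
    the letters there have the same parity. *)
Lemma encode_graft i u e v e' : size e = (size u).-1 -> (i < count negb u)%N ->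
  size e' = (size v).-1 -> v != [::] ->
  exists w0 w1, [/\ encode u e = w0 ++ inp :: w1, num_inp w0 = i,
    encode (graft_word i u v) (graft_edges (input_pos i u) e e') = w0 ++ encode v e' ++ w1,
    odd (count id (drop (input_pos i u) e)) = odd (size w1) &
    size (graft_edges (input_pos i u) e e') = (size (graft_word i u v)).-1].
Proof.
move=> se lti se' v0; have [u0 [u1 [eu ci ip]]] := input_posP lti.
rewrite /graft_word /graft_edges ip.
have s0 : size (take (size u0) e) = size u0.
  by rewrite size_takel // se eu size_cat /=; lia.
have s1 : size (drop (size u0) e) = size u1.
  by rewrite size_drop se eu size_cat /=; lia.
exists (head_word u0 (take (size u0) e)), (tail_word u1 (drop (size u0) e)); split.
- by rewrite -{1}(cat_take_drop (size u0) e) eu encode_head_cat.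
- by rewrite num_head_word.
- have -> : take (size u0) u = u0 by rewrite eu take_size_cat.
  have -> : drop (size u0).+1 u = u1.
    by rewrite eu -cat1s catA drop_size_cat // size_cat addn1.
  rewrite encode_head_cat //; last by case: (v) v0.
  by rewrite encode_tail_cat.
- by have [_ _ _ ->] := num_tail_word s1; rewrite -odd_count_negb s1.
- rewrite !size_cat s0 s1 se' size_takel; last by rewrite eu size_cat; lia.
  rewrite size_drop eu size_cat /=; case: (v) v0 => //= *; lia.
Qed.

(** An input letter is located by the number of input letters on its left. *)
Lemma num_inp_split w0 w1 w0' w1' : w0 ++ inp :: w1 = w0' ++ inp :: w1' ->
  num_inp w0 = num_inp w0' -> w0 = w0' /\ w1 = w1'.
Proof.
rewrite /num_inp; elim: w0 w0' => [|l w0 IH] [|l' w0'] /=.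
- by case=> ->.
- by case=> <-.
- by case=> ->.
by case=> -> /IH {}IH /addnI /IH[-> ->].
Qed.

Lemma valid_graft w0 w1 v : valid (w0 ++ inp :: w1) -> valid v ->
  valid (w0 ++ v ++ w1).
Proof.
have gapless p c : no_two_gaps p (Some c) by case: p.
rewrite /valid !rcons_cat !cat_path /= => /and3P[-> _ p1].
case: v => [//|[c|//] v] /=; rewrite -cats1 !cat_path gapless /= => /andP[-> /=].
by case: (last _ v) => [d|//] _; rewrite (path_some _ false).
Qed.

(** * The basis of words *)

Lemma recast_id (K : fieldType) (P : ns_operad K) n d (x : P n d) :
  recast x = x :> P n d.
Proof.
rewrite /recast; case: eqP => // e; case: eqP => // e'.
by rewrite (eq_irrelevance e erefl) (eq_irrelevance e' erefl).
Qed.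

Lemma recast_trans (K : fieldType) (P : ns_operad K) m n r p q s (x : P m p) :
  m = n -> p = q -> recast (recast x : P n q) = recast x :> P r s.
Proof. by move=> e e'; subst; rewrite recast_id. Qed.

Lemma recast_is_linear (K : fieldType) (P : ns_operad K) m n p q :
  linear (recast : P m p -> P n q).
Proof. by move=> a x y; exact: recastP. Qed.
HB.instance Definition _ (K : fieldType) (P : ns_operad K) m n p q :=
  GRing.isLinear.Build K (P m p) (P n q) *:%R (@recast K P m p n q)
    (@recast_is_linear K P m n p q).

(** The last clause computes the number of edges of a bamboo in two ways: one
    less than the vertices, minus the missing edges; and the degree corrected by
    [2 c] for each copy of the arity 0 element. *)
Definition bideg (c n : nat) (d : int) (w : seq letter) : bool :=
  [&& valid w, num_inp w == n &
    (num_inp w + num_blk w)%N%:Z ==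
      d + (num_blk w * c.*2)%N%:Z + (num_gap w)%:Z + 1].

Lemma sum_delta (R : nmodType) (T : finType) (P : pred T) (F : T -> R) t :
  P t -> (forall s, P s -> s != t -> F s = 0) -> \sum_(s | P s) F s = F t.
Proof.
move=> Pt F0; rewrite (bigD1 t) //= big1 ?addr0 // => s /andP[Ps st].
exact: F0.
Qed.

Lemma count_id_negb u : (count id u + count negb u = size u)%N.
Proof. exact: (count_predC id u). Qed.

Section Basis.
Variable K : fieldType.
Local Notation Q c := (coprod (ncGerst K) c).

Lemma encode_bideg c n d k (W : word n k) (E : bamboo (n + k) (d + (k * c.*2)%N%:Z)) :
  bideg c n d (encode (val W) (val E)) /\ num_blk (encode (val W) (val E)) = k.
Proof.
case: W E => W /= /eqP cW [E /= /andP[nk /eqP cE]].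
have sW : size W = (n + k)%N by rewrite size_tuple.
have W0 : (W : seq bool) != [::] by rewrite -size_eq0 sW -lt0n.
have sE : size E = (size W).-1 by rewrite !size_tuple.
have [eX eA eS _] := num_encode W0 sE.
have cWn := count_id_negb W; rewrite cW sW in cWn.
have cEn := count_id_negb E; rewrite sE sW in cEn.
rewrite /bideg eX eA eS cW encode_valid //=; split => //.
have -> : count negb W = n by lia.
by rewrite eqxx /=; apply/eqP; lia.
Qed.

Lemma bidegP c n d w k : bideg c n d w -> num_blk w = k ->
  exists (W : word n k) (E : bamboo (n + k) (d + (k * c.*2)%N%:Z)),
    w = encode (val W) (val E).
Proof.
case/and3P=> /validP[u [e [u0 se ->]]] /eqP; have [-> -> -> _] := num_encode u0 se.
move=> cn /eqP cd ck.
have cu := count_id_negb u; have ce := count_id_negb e.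
have cn' : count negb u = n by [].
have su : size u == (n + k)%N by apply/eqP; lia.
have u1 : (0 < size u)%N by case: (u) u0.
have se' : size e == (n + k).-1 by rewrite se (eqP su).
have cW : count id (Tuple su) == k by rewrite /= ck.
have cE : (0 < n + k)%N && ((count id (Tuple se'))%:Z == d + (k * c.*2)%N%:Z).
  by rewrite /= -(eqP su) u1 /=; apply/eqP; lia.
by exists (Sub (Tuple su) cW), (Sub (Tuple se') cE).
Qed.

(** A bamboo has fewer edges than vertices, and each copy of the arity 0 element
    raises the number of edges by [2 c >= 2] but that of vertices by 1. *)
Lemma bamboo_empty c n d k : (0 < c)%N -> (n + `|d| < k)%N ->
  bamboo (n + k) (d + (k * c.*2)%N%:Z) -> False.
Proof.
move=> c0 ltk [E /= /andP[nk /eqP cE]].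
have := count_size id E; rewrite size_tuple => le.
have : (k * 2 <= k * c.*2)%N by rewrite leq_mul2l; lia.
lia.
Qed.

Definition wbasis c n d (w : seq letter) : Q c n d :=
  fun k => [ffun W : word n k =>
    [ffun E : bamboo (n + k) (d + (k * c.*2)%N%:Z) => (encode (val W) (val E) == w)%:R]].

(** The bound on [k] is the one of [bamboo_empty], beyond which the components of
    a series vanish. *)
Definition lin_ext c n d (V : lmodType K) (f : seq letter -> V) (x : Q c n d) : V :=
  \sum_(k < (n + `|d|).+1) \sum_(W : word n k)
    \sum_(E : bamboo (n + k) (d + (k * c.*2)%N%:Z))
      (x k W E : K) *: f (encode (val W) (val E)).

Lemma lin_ext_is_linear c n d (V : lmodType K) f : linear (@lin_ext c n d V f).
Proof.
move=> a x y; rewrite /lin_ext scaler_sumr -big_split; apply: eq_bigr => k _ /=.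
rewrite scaler_sumr -big_split; apply: eq_bigr => W _ /=.
rewrite scaler_sumr -big_split; apply: eq_bigr => E _ /=.
by rewrite !ffunE scalerDl scalerA.
Qed.
HB.instance Definition _ c n d (V : lmodType K) (f : seq letter -> V) :=
  GRing.isLinear.Build K (Q c n d) V *:%R (@lin_ext c n d V f)
    (@lin_ext_is_linear c n d V f).

Lemma series_sumE (V : nat -> lmodType K) I (r : seq I) (P : pred I)
    (F : I -> series V) k :
  (\sum_(i <- r | P i) F i) k = \sum_(i <- r | P i) F i k.
Proof. by elim/big_rec2: _ => // i y x _ <-. Qed.

Lemma Q_ext c n d (x y : Q c n d) :
  (forall k (W : word n k) E, x k W E = y k W E) -> x = y.
Proof.
by move=> e; apply: functional_extensionality_dep => k; apply/ffunP => W; apply/ffunP.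
Qed.

Lemma encode_val_inj n k d (W W' : word n k) (E E' : bamboo (n + k) d) :
  encode (val W) (val E) = encode (val W') (val E') -> W = W' /\ E = E'.
Proof.
move=> /encode_inj[]; rewrite ?size_tuple //.
by move=> e1 e2; split; do 2 apply: val_inj.
Qed.

Lemma lin_ext_B c n d (V : lmodType K) (f : seq letter -> V) w :
  (0 < c)%N -> bideg c n d w -> @lin_ext c n d V f (wbasis c n d w) = f w.
Proof.
move=> c0 okw; have [W [E ew]] := bidegP okw (erefl _).
have ltk : (num_blk w < (n + `|d|).+1)%N.
  by rewrite ltnNge; apply/negP => /bamboo_empty/(_ E).
rewrite /lin_ext (bigD1 (Ordinal ltk)) //= [X in _ + X]big1 ?addr0; last first.
  move=> k /eqP kw; apply: big1 => W' _; apply: big1 => E' _; rewrite !ffunE.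
  case: eqP => [e|]; last by rewrite scale0r.
  by case: kw; apply: val_inj; rewrite /= -e (encode_bideg W' E').2.
have inj (W' : word n (num_blk w)) (E' : bamboo (n + num_blk w) _) :
    encode (val W') (val E') = w -> W' = W /\ E' = E.
  by move=> e; apply: encode_val_inj; exact: etrans e ew.
rewrite (bigD1 W) //= [X in _ + X]big1 ?addr0; last first.
  move=> W' /eqP W'W; apply: big1 => E' _; rewrite !ffunE.
  by case: eqP => [/inj[]|]; rewrite ?scale0r.
rewrite (bigD1 E) //= [X in _ + X]big1 ?addr0; last first.
  move=> E' /eqP E'E; rewrite !ffunE.
  by case: eqP => [/inj[]|]; rewrite ?scale0r.
by rewrite !ffunE -ew eqxx scale1r.
Qed.

(** With [lin_ext_B], this is the universal property of a free module: although
    its elements are series, [Q c n d] is spanned by the words of bidegree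
    [(n, d)]. *)
Lemma lin_ext_id c n d (x : Q c n d) : (0 < c)%N -> lin_ext (wbasis c n d) x = x.
Proof.
move=> c0; apply: Q_ext => k W E.
have ltk : (k < (n + `|d|).+1)%N.
  by rewrite ltnNge; apply/negP => /bamboo_empty/(_ E).
rewrite /lin_ext series_sumE !sum_ffunE (sum_delta (t := Ordinal ltk)) //; last first.
  move=> j _ jk; rewrite series_sumE !sum_ffunE; apply: big1 => W' _.
  rewrite series_sumE !sum_ffunE; apply: big1 => E' _; rewrite !ffunE.
  case: eqP => [e|]; last by rewrite scaler0.
  by case/eqP: jk; apply: val_inj; rewrite /= -(encode_bideg W E).2 e (encode_bideg W' E').2.
rewrite series_sumE !sum_ffunE /= (sum_delta (t := W)) //; last first.
  move=> W' _ WW; rewrite series_sumE !sum_ffunE; apply: big1 => E' _.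
  rewrite !ffunE.
  case: eqP => [/encode_val_inj[] e|]; last by rewrite scaler0.
  by rewrite e eqxx in WW.
rewrite series_sumE !sum_ffunE /= (sum_delta (t := E)) //; last first.
  move=> E' _ EE; rewrite !ffunE.
  case: eqP => [/encode_val_inj[] _ e|]; last by rewrite scaler0.
  by rewrite e eqxx in EE.
by rewrite !ffunE eqxx; exact: mulr1.
Qed.

Lemma recast_ncGerst_compE m n p q i (f : ncGerst K m p) (g : ncGerst K n q)
    r s (E : bamboo r s) : r = (m + n).-1 -> s = p + q ->
  (recast (ocomp i f g : ncGerst K (m + n).-1 (p + q)) : ncGerst K r s) E =
  \sum_(e1 : bamboo m p)
    \sum_(e2 : bamboo n q | graft_edges i (val e1) (val e2) == val E)
      graft_sign K i (val e1) (val e2) * f e1 * g e2.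
Proof. by move=> er es; subst; rewrite recast_id ffunE. Qed.

(** The sums in the definitions of composites run over all factorizations of the
    given composite word; only the factorization into the two given words counts,
    as a word determines its colours and its edges. *)
Lemma comp_B c m n p q i w0 w1 v :
  bideg c m p (w0 ++ inp :: w1) -> bideg c n q v -> i = num_inp w0 ->
  ocomp i (wbasis c m p (w0 ++ inp :: w1)) (wbasis c n q v) =
    (-1) ^+ (size w1 * (size v).-1) *: wbasis c (m + n).-1 (p + q) (w0 ++ v ++ w1).
Proof.
move=> okw okv ei; set w := w0 ++ inp :: w1 in okw *.
have lti : (i < m)%N.
  by case/and3P: okw => _ /eqP <- _; rewrite ei /num_inp /w count_cat /=; lia.
set s := (-1) ^+ _; apply: Q_ext => k W E.
pose summand j (u : word m j) (v' : word n (k - j)%N)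
    (e1 : bamboo (m + j) (p + (j * c.*2)%N%:Z))
    (e2 : bamboo (n + (k - j)) (q + ((k - j) * c.*2)%N%:Z)) : K :=
  [&& graft_word i (val u) (val v') == val W,
      graft_edges (input_pos i (val u)) (val e1) (val e2) == val E,
      encode (val u) (val e1) == w & encode (val v') (val e2) == v]%:R.
(* A factorization into the two given words has the given composite and sign. *)
have graftP j (u : word m j) (v' : word n (k - j)%N)
    (e1 : bamboo (m + j) (p + (j * c.*2)%N%:Z))
    (e2 : bamboo (n + (k - j)) (q + ((k - j) * c.*2)%N%:Z)) :
    encode (val u) (val e1) = w -> encode (val v') (val e2) = v ->
    [/\ encode (graft_word i (val u) (val v'))
          (graft_edges (input_pos i (val u)) (val e1) (val e2)) = w0 ++ v ++ w1,
      size (graft_edges (input_pos i (val u)) (val e1) (val e2)) =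
        (size (graft_word i (val u) (val v'))).-1 &
      graft_sign K (input_pos i (val u)) (val e1) (val e2) = s].
  move=> ew ev.
  have v0 : (val v' : seq bool) != [::].
    by have /andP[nk _] := valP e2; rewrite -size_eq0 size_tuple -lt0n.
  have u0 : (val u : seq bool) != [::].
    by have /andP[nk _] := valP e1; rewrite -size_eq0 size_tuple -lt0n.
  have se1 : size (val e1) = (size (val u)).-1 by rewrite !size_tuple.
  have se2 : size (val e2) = (size (val v')).-1 by rewrite !size_tuple.
  have ltiu : (i < count negb (val u))%N.
    have [<- _ _ _] := num_encode u0 se1.
    by case/and3P: (encode_bideg u e1).1 => _ /eqP-> _.
  have [w0' [w1' [ew' iw' eg od sg]]] := encode_graft se1 ltiu se2 v0.
  have [ew0 ew1] : w0 = w0' /\ w1 = w1'.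
    by apply: num_inp_split; rewrite -?ew' ?ew ?iw' ?ei.
  split=> //; first by rewrite eg ev ew0 ew1.
  rewrite /s /graft_sign -signr_odd oddM od -(odd_encode v0 se2) ev ew1.
  by rewrite -oddM signr_odd.
have summandP j u v' e1 e2 : summand j u v' e1 e2 != 0 ->
    [/\ w0 ++ v ++ w1 = encode (val W) (val E),
    graft_sign K (input_pos i (val u)) (val e1) (val e2) = s,
    encode (val u) (val e1) = w & encode (val v') (val e2) = v].
  rewrite /summand; case: and4P => [[/eqP gW /eqP gE /eqP ew /eqP ev] _|]; last by rewrite eqxx.
  by have [<- _ ->] := graftP _ _ _ _ _ ew ev; rewrite gW gE.
transitivity (s * \sum_(j < k.+1) \sum_u \sum_v' \sum_e1 \sum_e2 summand j u v' e1 e2).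
  rewrite /= /coprod_comp !sum_ffunE mulr_sumr; apply: eq_bigr => j _.
  rewrite ffunE sum_ffunE mulr_sumr; apply: eq_bigr => u _.
  rewrite sum_ffunE mulr_sumr big_mkcond; apply: eq_bigr => v' _.
  rewrite recast_ncGerst_compE; last first.
  - have /= := ltn_ord j; nia.
  - have /= := ltn_ord j; lia.
  case: ifP => C1; last first.
    rewrite mulr_sumr big1 // => e1 _; rewrite mulr_sumr big1 // => e2 _.
    by rewrite /summand C1 /= mulr0.
  rewrite mulr_sumr; apply: eq_bigr => e1 _.
  rewrite mulr_sumr big_mkcond; apply: eq_bigr => e2 _.
  rewrite /summand C1; case: ifP => C2; last by rewrite /= mulr0.
  rewrite !ffunE; case: (encode (val u) (val e1) =P w) => ew /=;
    last by rewrite mulr0 mul0r mulr0.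
  case: (encode (val v') (val e2) =P v) => ev /=; last by rewrite !mulr0.
  by have [_ _ ->] := graftP _ _ _ _ _ ew ev; rewrite !mulr1.
rewrite !ffunE; case: eqP => [ew|new]; last first.
  rewrite scaler0 big1 ?mulr0 // => j _; do 4 (apply: big1 => ? _).
  by apply/eqP; apply: contra_notT new => /summandP[].
congr (_ * _).
(* From here on the composite word is [w0 v w1], and the only nonzero summand is
   singled out one index after the other. *)
have ek : k = (num_blk w + num_blk v)%N.
  have := (encode_bideg W E).2; rewrite ew /w /num_blk !count_cat /=; lia.
have ltj : (num_blk w < k.+1)%N by rewrite ek; lia.
rewrite (sum_delta (t := Ordinal ltj)) //; last first.
  move=> j _ jw; do 4 (apply: big1 => ? _).
  apply/eqP; apply: contraNT jw => /summandP[_ _ e1 _]; apply/eqP/val_inj => /=.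
  by rewrite -e1 (encode_bideg _ _).2.
have [u [e1 eu]] := bidegP okw (erefl _).
have kj : num_blk v = (k - num_blk w)%N by rewrite ek; lia.
have [v' [e2 ev]] := bidegP okv kj.
rewrite (sum_delta (t := u)) //; last first.
  move=> u' _ uu; do 3 (apply: big1 => ? _).
  apply/eqP; apply: contraNT uu => /summandP[_ _ e _]; apply/eqP.
  by have [] := encode_val_inj (etrans e eu).
rewrite (sum_delta (t := v')) //; last first.
  move=> u' _ uu; do 2 (apply: big1 => ? _).
  apply/eqP; apply: contraNT uu => /summandP[_ _ _ e]; apply/eqP.
  by have [] := encode_val_inj (etrans e ev).
rewrite (sum_delta (t := e1)) //; last first.
  move=> u' _ uu; apply: big1 => ? _.
  apply/eqP; apply: contraNT uu => /summandP[_ _ e _]; apply/eqP.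
  by have [] := encode_val_inj (etrans e eu).
rewrite (sum_delta (t := e2)) //; last first.
  move=> u' _ uu.
  apply/eqP; apply: contraNT uu => /summandP[_ _ _ e]; apply/eqP.
  by have [] := encode_val_inj (etrans e ev).
have [eg sg _] := graftP _ _ _ _ _ (esym eu) (esym ev).
have sE : size (val E) = (size (val W)).-1 by rewrite !size_tuple.
have [gW gE] := encode_inj sg sE (etrans eg (esym ew)).
rewrite /summand gW gE; by rewrite -eu -ev !eqxx.
Qed.

End Basis.

(** * Linear maps on the completed coproduct *)

Section Linear.
Variables (K : fieldType).
Local Notation Q c := (coprod (ncGerst K) c).

Lemma ncGerst_ocompPl m n p q i (g : ncGerst K n q) :
  linear (fun f : ncGerst K m p => ocomp i f g).
Proof.
move=> a f f'; apply/ffunP => e; rewrite !ffunE scaler_sumr -big_split.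
apply: eq_bigr => e1 _ /=; rewrite scaler_sumr -big_split; apply: eq_bigr => e2 _.
by rewrite !ffunE /= mulrDr mulrDl; congr (_ + _); rewrite /GRing.scale /=; ring.
Qed.

Lemma ncGerst_ocompPr m n p q i (f : ncGerst K m p) :
  linear (fun g : ncGerst K n q => ocomp i f g).
Proof.
move=> a g g'; apply/ffunP => e; rewrite !ffunE scaler_sumr -big_split.
apply: eq_bigr => e1 _ /=; rewrite scaler_sumr -big_split; apply: eq_bigr => e2 _.
by rewrite !ffunE /= mulrDr; congr (_ + _); rewrite /GRing.scale /=; ring.
Qed.

Lemma coprod_ocompE (P : ns_operad K) c m n p q i (x : coprod P c m p)
    (y : coprod P c n q) k (W : word (m + n).-1 k) :
  (ocomp i x y : coprod P c _ _) k W = \sum_(j < k.+1) \sum_(u : word m j)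
    \sum_(v : word n (k - j)%N | graft_word i (val u) (val v) == val W)
        recast (ocomp (input_pos i (val u)) (x j u) (y (k - j)%N v)).
Proof. by rewrite /= /coprod_comp sum_ffunE; apply: eq_bigr => j _; rewrite ffunE. Qed.

Lemma coprod_linE (P : ns_operad K) c n d (a : K) (x y : coprod P c n d) k (W : word n k) :
  (a *: x + y) k W = a *: x k W + y k W.
Proof. by rewrite [LHS]ffunE; congr (_ + _); rewrite ffunE. Qed.

Lemma ocompPl c m n p q i (y : Q c n q) : linear (fun x : Q c m p => ocomp i x y).
Proof.
move=> a x x'; apply: Q_ext => k W E; congr (fun_of_fin _ E).
rewrite coprod_linE !coprod_ocompE.
rewrite scaler_sumr -big_split; apply: eq_bigr => j _; cbv beta.
rewrite scaler_sumr -big_split; apply: eq_bigr => u _; cbv beta.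
rewrite scaler_sumr -big_split; apply: eq_bigr => v _; cbv beta.
by rewrite coprod_linE ncGerst_ocompPl recastP.
Qed.

Lemma ocompPr c m n p q i (x : Q c m p) : linear (fun y : Q c n q => ocomp i x y).
Proof.
move=> a y y'; apply: Q_ext => k W E; congr (fun_of_fin _ E).
rewrite coprod_linE !coprod_ocompE.
rewrite scaler_sumr -big_split; apply: eq_bigr => j _; cbv beta.
rewrite scaler_sumr -big_split; apply: eq_bigr => u _; cbv beta.
rewrite scaler_sumr -big_split; apply: eq_bigr => v _; cbv beta.
by rewrite coprod_linE ncGerst_ocompPr recastP.
Qed.

Lemma recast_ocompPl c m n p q r s i (y : Q c n q) :
  linear (fun x : Q c m p => recast (ocomp i x y) : Q c r s).
Proof. by move=> a x x'; rewrite ocompPl; exact: recastP. Qed.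

Lemma recast_ocompPr c m n p q r s i (x : Q c m p) :
  linear (fun y : Q c n q => recast (ocomp i x y) : Q c r s).
Proof. by move=> a y y'; rewrite ocompPr; exact: recastP. Qed.

Section LinearFacts.
Variables (U V W : lmodType K).

(** The next lemmas take linearity as a hypothesis rather than as a structure, so
    that they apply to composition with one argument fixed. *)
Lemma linear_for0 (f : U -> V) : linear f -> f 0 = 0.
Proof. by move=> lf; have := lf (-1) 0 0; rewrite scaler0 addr0 scaleN1r addNr. Qed.

Lemma linear_forD (f : U -> V) x y : linear f -> f (x + y) = f x + f y.
Proof. by move=> lf; have := lf 1 x y; rewrite !scale1r. Qed.

Lemma linear_forZ (f : U -> V) a x : linear f -> f (a *: x) = a *: f x.
Proof. by move=> lf; have := lf a x 0; rewrite !addr0 linear_for0 // addr0. Qed.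

Lemma linear_for_sum (f : U -> V) I (r : seq I) (P : pred I) F : linear f ->
  f (\sum_(i <- r | P i) F i) = \sum_(i <- r | P i) f (F i).
Proof.
move=> lf; elim/big_rec2: _ => [|i x y _ <-]; first exact: linear_for0.
exact: linear_forD.
Qed.

Lemma linear_for_comp (f : V -> W) (g : U -> V) : linear f -> linear g ->
  linear (fun x => f (g x)).
Proof. by move=> lf lg a x y; rewrite lg lf. Qed.

Lemma linear_for_add (f g : U -> V) : linear f -> linear g ->
  linear (fun x => f x + g x).
Proof. by move=> lf lg a x y; rewrite lg lf scalerDr addrACA. Qed.

Lemma linear_for_scale (f : U -> V) b : linear f -> linear (fun x => b *: f x).
Proof. by move=> lf a x y; rewrite lf scalerDr !scalerA mulrC. Qed.

Lemma linear_for_bigsum I (r : seq I) (P : pred I) (F : I -> U -> V) :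
  (forall i, P i -> linear (F i)) -> linear (fun x => \sum_(i <- r | P i) F i x).
Proof.
move=> lF a x y; rewrite scaler_sumr -big_split; apply: eq_bigr => i Pi.
exact: lF.
Qed.
End LinearFacts.

Lemma lin_ext_lin c n d (V W : lmodType K) (g : V -> W) f (x : Q c n d) : linear g ->
  g (lin_ext f x) = lin_ext (fun w => g (f w)) x.
Proof.
move=> lg; rewrite /lin_ext linear_for_sum //; apply: eq_bigr => k _.
rewrite linear_for_sum //; apply: eq_bigr => u _.
rewrite linear_for_sum //; apply: eq_bigr => e _; exact: linear_forZ.
Qed.

Lemma lin_ext_ext c n d (V : lmodType K) (f g : seq letter -> V) (x : Q c n d) :
  (forall w, bideg c n d w -> f w = g w) -> lin_ext f x = lin_ext g x.
Proof.
move=> fg; do 3 (apply: eq_bigr => ? _); congr (_ *: _); apply: fg.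
exact: (encode_bideg _ _).1.
Qed.

(** The main tool for identities between maps out of the completed coproduct: it
    is enough to check them on words. *)
Lemma Q_linear_ext c n d (V : lmodType K) (f g : Q c n d -> V) : (0 < c)%N ->
  linear f -> linear g ->
  (forall w, bideg c n d w -> f (wbasis K c n d w) = g (wbasis K c n d w)) -> forall x, f x = g x.
Proof.
move=> c0 lf lg fg x; rewrite -(lin_ext_id x c0) !lin_ext_lin //.
exact: lin_ext_ext.
Qed.

Lemma comp_recast_B c m n p q r s i w0 w1 v :
  bideg c m p (w0 ++ inp :: w1) -> bideg c n q v -> i = num_inp w0 ->
  r = (m + n).-1 -> s = p + q ->
  recast (ocomp i (wbasis K c m p (w0 ++ inp :: w1)) (wbasis K c n q v)) =
    (-1) ^+ (size w1 * (size v).-1) *: wbasis K c r s (w0 ++ v ++ w1).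
Proof. by move=> *; subst; rewrite recast_id comp_B. Qed.

Lemma recast_ne (P : ns_operad K) m n p q (x : P m p) : m != n -> recast x = 0 :> P n q.
Proof. by move=> /eqP mn; rewrite /recast; case: eqP. Qed.

Lemma recast_bambooE n d m p (x : ncGerst K n d) (E : bamboo m p) :
  n = m -> d = p ->
  exists2 E' : bamboo n d, val E = val E' :> seq bool &
    (recast x : ncGerst K m p) E = x E'.
Proof. by move=> en ed; subst; exists E => //; rewrite recast_id. Qed.

(** Only the component with no copy of the arity 0 element survives [recast]. *)
Lemma incl_B c n d (x : ncGerst K n d) :
  coprod_incl c x = \sum_(e : bamboo n d) x e *: wbasis K c n d (encode (nseq n false) (val e)).
Proof.
apply: Q_ext => k; rewrite series_sumE; case: k => [|k] W E; last first.
  rewrite ffunE recast_ne; last by apply/eqP; lia.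
  rewrite !sum_ffunE big1 ?ffunE // => e _; rewrite !ffunE.
  case: eqP => [en|_]; last by rewrite scaler0.
  have /andP[n0 _] := valP e.
  have ns : nseq n false != [::] by rewrite -size_eq0 size_nseq -lt0n.
  have se : size (val e) = (size (nseq n false)).-1 by rewrite size_nseq size_tuple.
  have [_ eb _ _] := num_encode ns se.
  have := (encode_bideg W E).2; rewrite en eb count_nseq mul0n; lia.
rewrite ffunE !sum_ffunE.
have eW : val W = nseq n false :> seq bool.
  case: W {E} => W cW /=; apply: (@eq_from_nth _ false) => [|j lj].
    by rewrite size_tuple size_nseq addn0.
  rewrite nth_nseq if_same; apply: contraTF cW => Wj; rewrite -lt0n -has_count.
  by apply/hasP; exists (nth false W j) => //; apply: mem_nth.
have [E' eE ->] := recast_bambooE x E (esym (addn0 n)) (esym (addr0 d)).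
rewrite (sum_delta (t := E')) // => [|e _ eE'].
  by rewrite !ffunE eW eE eqxx; symmetry; exact: mulr1.
rewrite !ffunE eW eE; case: eqP => [en|_]; last by rewrite scaler0.
have [] := encode_inj _ _ en; rewrite ?size_nseq ?size_tuple //.
by move=> _ /val_inj/val_inj ee; rewrite ee eqxx in eE'.
Qed.

Lemma elt_B c : coprod_elt (ncGerst K) c = wbasis K c 0 (- (c.*2)%:Z) [:: blk].
Proof.
apply: Q_ext => k W E; rewrite !ffunE.
have [k1|k1] := eqVneq k 1%N; last first.
  rewrite recast_ne 1?eq_sym // ffunE; case: eqP => // en.
  by have := (encode_bideg W E).2; rewrite -en => k1'; rewrite -k1' in k1.
subst k; have [E' _ ->] := recast_bambooE (ounit (ncGerst K)) E
  (erefl _) (esym (etrans (congr1 _ (congr1 Posz (mul1n _))) (addNr _))).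
rewrite ffunE; case: W E {E'} => -[[|b [|b' W]] sW] //= cW [[[|e E] sE] pE] //=.
by case: b cW sW => // cW sW; rewrite eqxx.
Qed.

Lemma unit_B c : ounit (Q c) = wbasis K c 1 0 [:: inp].
Proof.
rewrite /= incl_B.
have b0 : (0 < 1)%N && ((count id [tuple of [::]])%:Z == 0) by [].
rewrite (sum_delta (t := (Sub [tuple] b0 : bamboo 1 0))) //.
  by rewrite ffunE scale1r.
by move=> [e pe] _ /eqP[]; apply: val_inj; rewrite /= (tuple0 e).
Qed.

End Linear.

(** * The differential on words *)

Section WordDifferential.
Variable K : fieldType.

(** The Koszul derivation [a -> aa], [s -> as + sa], [x -> 0], in transposed form:
    it acts on functions of words instead of formal sums of words.  The identities
    between sums of words become identities in the target module, with no
    finiteness condition to carry along. *)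
Fixpoint wdiff (V : lmodType K) (f : seq letter -> V) (w : seq letter) : V :=
  if w is l :: w' then
    match l with
    | Some false => 0
    | Some true => f (blk :: blk :: w')
    | None => f (blk :: gap :: w') + f (gap :: blk :: w')
    end - wdiff (fun u => f (l :: u)) w'
  else 0.

(** The words that occur in the differential of a given word. *)
Inductive wstep : seq letter -> seq letter -> Prop :=
  | StepBlk l r : wstep (l ++ blk :: r) (l ++ blk :: blk :: r)
  | StepGapL l r : wstep (l ++ gap :: r) (l ++ blk :: gap :: r)
  | StepGapR l r : wstep (l ++ gap :: r) (l ++ gap :: blk :: r).

Lemma wstep_cons x w u : wstep w u -> wstep (x :: w) (x :: u).
Proof.
case=> l r; rewrite -!cat_cons;
 [exact: StepBlk | exact: StepGapL | exact: StepGapR].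
Qed.

Lemma wdiff_ext (V : lmodType K) (f g : seq letter -> V) w :
  (forall u, wstep w u -> f u = g u) -> wdiff f w = wdiff g w.
Proof.
elim: w f g => //= l w IH f g fg; congr (_ - _); last first.
  by apply: IH => u wu; apply: fg; apply: wstep_cons.
case: l fg => [[]|] // fg; first exact: (fg _ (StepBlk [::] w)).
by rewrite (fg _ (StepGapL [::] w)) (fg _ (StepGapR [::] w)).
Qed.

Lemma wdiff_lin (V W : lmodType K) (g : V -> W) f w : linear g ->
  g (wdiff f w) = wdiff (fun u => g (f u)) w.
Proof.
move=> lg; elim: w f => /= [|l w IH] f; first exact: linear_for0.
rewrite linear_forD // -scaleN1r linear_forZ // scaleN1r IH; congr (_ - _).
by case: l => [[]|]; rewrite ?linear_for0 ?linear_forD.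
Qed.

Lemma wdiffZ (V : lmodType K) a (f : seq letter -> V) w :
  wdiff (fun u => a *: f u) w = a *: wdiff f w.
Proof.
by rewrite (wdiff_lin (g := fun x => a *: x)) // => b x y; rewrite scalerDr !scalerA mulrC.
Qed.

Lemma wdiffB (V : lmodType K) (f g : seq letter -> V) w :
  wdiff (fun u => f u - g u) w = wdiff f w - wdiff g w.
Proof.
elim: w f g => /= [|l w IH] f g; first by rewrite subr0.
have sub4 (x y z t : V) : x - y - (z - t) = x - z - (y - t).
  by rewrite !opprD !opprK addrACA.
rewrite IH; case: l => [[]|].
- exact: sub4.
- by rewrite -[RHS]sub4 subr0.
by rewrite -[RHS]sub4; congr (_ - _); rewrite opprD addrACA.
Qed.

Lemma wdiff0 (V : lmodType K) w : wdiff (fun=> 0 : V) w = 0.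
Proof. by elim: w => //= -[[]|] w ->; rewrite subr0 ?addr0. Qed.

Lemma wdiffN (V : lmodType K) (f : seq letter -> V) w :
  wdiff (fun u => - f u) w = - wdiff f w.
Proof.
by rewrite (wdiff_lin (g := fun x => - x)) // => b x y; rewrite opprD scalerN.
Qed.

Lemma wdiffD (V : lmodType K) (f g : seq letter -> V) w :
  wdiff (fun u => f u + g u) w = wdiff f w + wdiff g w.
Proof.
rewrite -[wdiff g w]opprK -wdiffN -wdiffB.
by apply: wdiff_ext => u _; rewrite opprK.
Qed.

(** The Leibniz rule. *)
Lemma wdiff_cat (V : lmodType K) (f : seq letter -> V) w0 w1 :
  wdiff f (w0 ++ w1) = wdiff (fun u => f (u ++ w1)) w0 +
    (-1) ^+ size w0 *: wdiff (fun u => f (w0 ++ u)) w1.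
Proof.
elim: w0 f => /= [|l w0 IH] f; first by rewrite scale1r add0r.
by rewrite IH opprD addrA exprS mulN1r scaleNr.
Qed.

(** By induction on the word, since the derivation squares to zero on letters:
    [a -> aa -> aaa - aaa], and [as + sa -> aas - a(as + sa) + (as + sa)a - saa]. *)
Lemma wdiff_wdiff (V : lmodType K) (f : seq letter -> V) w :
  wdiff (wdiff f) w = 0.
Proof.
elim: w f => //= l w IH f; case: l => [[]|] /=; rewrite wdiffB IH subr0.
- by rewrite subKr subrr.
- by rewrite wdiff0 subr0.
rewrite wdiffD; move: (f _) (f _) (f _) (wdiff _ w) (wdiff _ w) => z y x b a.
have -> : x - (x + y - a) = a - y by rewrite opprB addrCA opprD addNKr.
have -> : y + z - (z - b) = y + b by rewrite opprB addrACA subrr addr0.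
by rewrite addrA subrK subrr.
Qed.

Lemma size_num w : size w = (num_inp w + num_blk w + num_gap w)%N.
Proof.
elim: w => //= l w ->; rewrite /num_inp /num_blk /num_gap /=.
by case: l => [[]|] /=; lia.
Qed.

(** A new black vertex is always adjacent to a letter that is already there, and
    can only separate gaps. *)
Lemma valid_wstep l r w u : wstep w u -> valid (l ++ w ++ r) -> valid (l ++ u ++ r).
Proof.
have weaken c s : path no_two_gaps gap s -> path no_two_gaps (Some c) s.
  by case: s => //= -[d|].
case=> l' r'; rewrite -!catA /= ![l ++ l' ++ _]catA;
  rewrite /valid !rcons_cat !cat_path /=; case: (last _ (l ++ l')) => [c|] //=.
- by rewrite andbF.
- by case/andP=> -> /weaken->.
Qed.

Lemma wstepP w u : wstep w u ->
  [/\ num_inp u = num_inp w, num_blk u = (num_blk w).+1, num_gap u = num_gap w &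
      size u = (size w).+1].
Proof.
rewrite /num_inp /num_blk /num_gap.
by case=> l r; rewrite !count_cat !size_cat /=; split; lia.
Qed.

Lemma bideg_wstep c n d w u : bideg c n d w -> wstep w u -> bideg c n (d + 1 - (c.*2)%:Z) u.
Proof.
case/and3P=> vw /eqP nw /eqP dw wu; have [eX eA eS _] := wstepP wu.
apply/and3P; split; last by rewrite eX eA eS; apply/eqP; lia.
  by have := @valid_wstep [::] [::] _ _ wu; rewrite !cats0; apply.
by rewrite eX nw.
Qed.

End WordDifferential.

(** The degree is the number of edges modulo 2, hence has the parity of the length
    minus one. *)
Lemma bideg_odd c n d w : bideg c n d w -> odd `|d|%N = odd (size w).-1.
Proof.
case/and3P=> vw _ /eqP; rewrite -mul2n mulnCA.
have : (0 < size w)%N by case: (w) vw.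
rewrite size_num; lia.
Qed.

Lemma eq_sign (K : fieldType) a b : odd a = odd b -> (-1) ^+ a = (-1) ^+ b :> K.
Proof. by move=> e; rewrite -signr_odd e signr_odd. Qed.

Lemma inp_split w i : (i < num_inp w)%N ->
  exists w0 w1, w = w0 ++ inp :: w1 /\ i = num_inp w0.
Proof.
rewrite /num_inp; elim: w i => [//|l w IH] i /= lti.
case: eqP lti => [-> | nl] lti.
  case: i lti => [|i] lti; first by exists [::], w.
  by have [w0 [w1 [-> ->]]] := IH i lti; exists (inp :: w0), w1.
have [w0 [w1 [-> ->]]] := IH i lti; exists (l :: w0), w1; split=> //=.
by case: eqP.
Qed.

Lemma bideg_graft c m n p q w0 w1 v :
  bideg c m p (w0 ++ inp :: w1) -> bideg c n q v ->
  bideg c (m + n).-1 (p + q) (w0 ++ v ++ w1).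
Proof.
case/and3P=> vw /eqP <- /eqP dw /and3P[vv /eqP <- /eqP dv].
apply/and3P; split; first exact: valid_graft.
  by apply/eqP; rewrite /num_inp !count_cat /=; lia.
move: dw dv; rewrite /num_inp /num_blk /num_gap !count_cat /= => dw dv.
by apply/eqP; lia.
Qed.

(** * The twisting differential *)

Section Twisting.
Variable K : fieldType.
Local Notation B := (wbasis K).

Definition tw_diff n d (x : Tw K n d) : Tw K n (d - 1) :=
  lin_ext (wdiff (B 1 n (d - 1))) x.

HB.instance Definition _ n d :=
  GRing.isLinear.Build K (Tw K n d) (Tw K n (d - 1)) *:%R (@tw_diff n d)
    (lin_ext_is_linear (wdiff (B 1 n (d - 1)))).

Definition twD n d : {linear Tw K n d -> Tw K n (d - 1)} := @tw_diff n d.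

Lemma twD_B n d w : bideg 1 n d w -> twD n d (B 1 n d w) = wdiff (B 1 n (d - 1)) w.
Proof. by move=> okw; rewrite /twD /= /tw_diff lin_ext_B. Qed.

Lemma bideg_wstep1 n d w u : bideg 1 n d w -> wstep w u -> bideg 1 n (d - 1) u.
Proof.
move=> okw wu; have := bideg_wstep okw wu.
by congr bideg; lia.
Qed.

Lemma linear_twD n d : linear (twD n d).
Proof. by move=> a x y; exact: linearP. Qed.

Lemma recast_linear (P : ns_operad K) m p n q : linear (recast : P m p -> P n q).
Proof. exact: recast_is_linear. Qed.

Lemma twD_twD n d (x : Tw K n d) : twD _ _ (twD n d x) = 0.
Proof.
move: x; apply: (@Q_linear_ext K 1 n d _ (fun x => twD _ _ (twD n d x)) (fun=> 0)) => //.
- by apply: linear_for_comp; exact: linear_twD.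
- by move=> a x y; rewrite scaler0 addr0.
move=> w okw; rewrite twD_B // wdiff_lin; last exact: linear_twD.
transitivity (wdiff (wdiff (B 1 n (d - 1 - 1))) w); last exact: wdiff_wdiff.
by apply: wdiff_ext => u wu; rewrite twD_B //; exact: bideg_wstep1 okw wu.
Qed.

Lemma step_left w0 w1 u : wstep w0 u -> wstep (w0 ++ w1) (u ++ w1).
Proof.
by case=> l r; rewrite -!catA !cat_cons; constructor.
Qed.

Lemma step_right w0 w1 u : wstep w1 u -> wstep (w0 ++ w1) (w0 ++ u).
Proof. by case=> l r; rewrite !catA; constructor. Qed.

(** On words, both sides expand by the Leibniz rule over [w0 v w1]; the derivative
    of the input letter at which [v] is plugged vanishes, and it remains to compare
    the signs of the three groups of terms. *)
Lemma twD_deriv m n p q i (x : Tw K m p) (y : Tw K n q) : (i < m)%N ->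
  twD _ _ (ocomp i x y) = recast (ocomp i (twD _ _ x) y)
    + (-1) ^+ `|p|%N *: recast (ocomp i x (twD _ _ y)).
Proof.
move=> lti; move: x; apply: Q_linear_ext => //.
- by apply: linear_for_comp; [exact: linear_twD | exact: ocompPl].
- apply: linear_for_add.
    apply: linear_for_comp; first exact: recast_linear.
    apply: (linear_for_comp (f := fun x => ocomp i x y)); first exact: ocompPl.
    exact: linear_twD.
  apply: linear_for_scale; apply: linear_for_comp; first exact: recast_linear.
  exact: ocompPl.
move=> w okw; move: y; apply: Q_linear_ext => //.
- by apply: linear_for_comp; [exact: linear_twD | exact: ocompPr].
- apply: linear_for_add.
    apply: linear_for_comp; first exact: recast_linear.
    exact: ocompPr.
  apply: linear_for_scale; apply: linear_for_comp; first exact: recast_linear.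
  by apply: linear_for_comp; [exact: ocompPr | exact: linear_twD].
move=> v okv.
have [w0 [w1 [ew iw]]] : exists w0 w1, w = w0 ++ inp :: w1 /\ i = num_inp w0.
  by apply: inp_split; case/and3P: okw => _ /eqP -> _.
subst w; rewrite comp_B // linear_forZ; last exact: linear_twD.
have okg := bideg_graft okw okv.
rewrite !twD_B //.
have lr : linear (fun y : Tw K n (q - 1) => recast (ocomp i (B 1 m p (w0 ++ inp :: w1)) y)
                       : Tw K (m + n).-1 (p + q - 1)).
  exact: recast_ocompPr.
have ll : linear (fun x : Tw K m (p - 1) => recast (ocomp i x (B 1 n q v))
                       : Tw K (m + n).-1 (p + q - 1)).
  exact: recast_ocompPl.
rewrite (wdiff_lin _ _ lr) (wdiff_lin _ _ ll) !wdiff_cat /= sub0r.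
have v0 : (0 < size v)%N by case/and3P: okv; case: (v).
have ew0 : wdiff (fun u => recast (ocomp i (B 1 m (p - 1) (u ++ inp :: w1)) (B 1 n q v))
                       : Tw K (m + n).-1 (p + q - 1)) w0 =
    (-1) ^+ (size w1 * (size v).-1) *:
      wdiff (fun u => B 1 (m + n).-1 (p + q - 1) (u ++ v ++ w1)) w0.
  rewrite -wdiffZ; apply: wdiff_ext => u wu; rewrite comp_recast_B //; last lia.
    by apply: bideg_wstep1 okw _; exact: step_left.
  by rewrite iw; have [-> _ _ _] := wstepP wu.
have ew1 : wdiff (fun u => recast (ocomp i (B 1 m (p - 1) (w0 ++ inp :: u)) (B 1 n q v))
                       : Tw K (m + n).-1 (p + q - 1)) w1 =
    (-1) ^+ ((size w1).+1 * (size v).-1) *: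
      wdiff (fun u => B 1 (m + n).-1 (p + q - 1) (w0 ++ v ++ u)) w1.
  rewrite -wdiffZ; apply: wdiff_ext => u wu; rewrite comp_recast_B //; last lia.
    by have [_ _ _ ->] := wstepP wu.
  by apply: bideg_wstep1 okw _; apply: step_right; exact: wstep_cons.
have ev : wdiff (fun u => recast (ocomp i (B 1 m p (w0 ++ inp :: w1)) (B 1 n (q - 1) u))
                       : Tw K (m + n).-1 (p + q - 1)) v =
    (-1) ^+ (size w1 * size v) *:
      wdiff (fun u => B 1 (m + n).-1 (p + q - 1) (w0 ++ u ++ w1)) v.
  rewrite -wdiffZ; apply: wdiff_ext => u wu; rewrite comp_recast_B //; last lia.
    by have [_ _ _ ->] := wstepP wu.
  exact: bideg_wstep1 okv wu.
have op : odd `|p|%N = odd (size w0 + size w1).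
  by rewrite (bideg_odd okw) size_cat addnS.
rewrite ew0 ew1 ev !scalerDr [LHS]addrA [RHS]addrAC !scalerA -scaleN1r !scalerA.
move: (wdiff _ w0) (wdiff _ v) (wdiff _ w1) => d0 dv d1.
rewrite -!exprD -mulrA -exprS -exprD.
have sg0 : (-1) ^+ (size w1 * (size v).-1 + size w0) =
           (-1) ^+ (`|p| + size w1 * size v) :> K.
  apply: eq_sign; rewrite !oddD !oddM op oddD.
  by case: (size v) v0 => //= k _; case: (odd k); case: (odd (size w0)); case: (odd (size w1)).
have sg1 : (-1) ^+ (size w1 * (size v).-1 + size w0 + size v) =
           (-1) ^+ (size w0 + ((size w1).+1 * (size v).-1).+1) :> K.
  apply: eq_sign; rewrite /= !oddD /= !oddM /=.
  by case: (size v) v0 => //= k _; case: (odd k); case: (odd (size w0)); case: (odd (size w1)).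
by rewrite sg0 addnA sg1.
Qed.

End Twisting.

(** Used with a term of the filtration for [F]. *)
Lemma wdiff_closed (K : fieldType) (V : lmodType K) (F : V -> Prop) f w :
  F 0 -> (forall a u v, F u -> F v -> F (a *: u + v)) ->
  (forall u, wstep w u -> F (f u)) -> F (wdiff f w).
Proof.
move=> F0 FP; elim: w f => [|l w IH] f fu //=.
have /IH {}IH : forall u, wstep w u -> F (f (l :: u)).
  by move=> u wu; apply: fu; apply: wstep_cons.
rewrite addrC -scaleN1r; apply: (FP) => //.
case: l fu {IH} => [[]|] fu //; first exact: (fu _ (StepBlk [::] w)).
rewrite -[X in X + _]scale1r; apply: FP.
  exact: (fu _ (StepGapL [::] w)).
exact: (fu _ (StepGapR [::] w)).
Qed.

Section Filtration.
Variable K : fieldType.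
Local Notation Q c := (coprod (ncGerst K) c).
Local Notation B := (wbasis K).

Lemma ofilt_Q c n d p (x : Q c n d) :
  ofilt p x <-> (forall k (W : word n k), (k < p)%N -> x k W = 0).
Proof.
split=> H k W.
  by move=> kp; case: (H k W) => // /eqP; rewrite subn_eq0 leqNgt kp.
case: (ltnP k p) => kp; last by left; apply/eqP; rewrite subn_eq0.
by right; exact: H.
Qed.

Lemma ofilt_B c n d p w : (p <= num_blk w)%N -> ofilt p (B c n d w).
Proof.
move=> pw; apply/ofilt_Q => k W kp; apply/ffunP => E; rewrite !ffunE.
have [en|//] := eqVneq (encode (val W) (val E)) w.
by have := (encode_bideg W E).2; rewrite en => ek; rewrite ek leqNgt kp in pw.
Qed.

Lemma lin_ext_filt c n d p (V : lmodType K) (F : V -> Prop) f (x : Q c n d) :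
  F 0 -> (forall a u v, F u -> F v -> F (a *: u + v)) ->
  (forall w, bideg c n d w -> (p <= num_blk w)%N -> F (f w)) ->
  ofilt p x -> F (lin_ext f x).
Proof.
move=> F0 FP Ff /ofilt_Q xp.
have FD u v : F u -> F v -> F (u + v).
  by move=> Fu Fv; rewrite -[u]scale1r; exact: FP.
rewrite /lin_ext; apply: (big_ind F) => // k _; apply: (big_ind F) => // W _.
apply: (big_ind F) => // E _; rewrite -[_ *: _]addr0.
case: (ltnP k p) => kp; first by rewrite xp // ffunE scale0r addr0.
apply: FP => //; apply: Ff; first exact: (encode_bideg W E).1.
by rewrite (encode_bideg W E).2.
Qed.

Lemma ofilt_lin c n d p a (x y : Q c n d) : ofilt p x -> ofilt p y -> ofilt p (a *: x + y).
Proof.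
move=> /ofilt_Q xp /ofilt_Q yp; apply/ofilt_Q => k W kp.
by rewrite coprod_linE xp // yp // scaler0 addr0.
Qed.

Lemma ofilt0 c n d p : ofilt p (0 : Q c n d).
Proof. by apply/ofilt_Q => k W kp; rewrite ffunE. Qed.

(** In a fixed bidegree the filtration is finite, as the number of copies of the
    arity 0 element is bounded. *)
Lemma ofilt_large c n d p (x : Q c n d) : (0 < c)%N -> (n + `|d| < p)%N -> ofilt p x -> x = 0.
Proof.
move=> c0 ltp /ofilt_Q xp; apply: Q_ext => k W E.
case: (ltnP k p) => kp; first by rewrite xp //= !ffunE.
by have [] := bamboo_empty c0 (leq_trans ltp kp) E.
Qed.

End Filtration.

Section TwistingProperties.
Variable K : fieldType.
Local Notation B := (wbasis K).

Lemma recast_B c m n p q w : m = n -> p = q -> recast (B c m p w) = B c n q w.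
Proof. by move=> em ep; subst; rewrite recast_id. Qed.

Lemma twD_filt p n d (x : Tw K n d) : ofilt p x -> ofilt p (twD K n d x).
Proof.
apply: lin_ext_filt => [|a u v|w okw pw]; [exact: ofilt0 | exact: ofilt_lin |].
apply: wdiff_closed => [|a u v|u wu]; [exact: ofilt0 | exact: ofilt_lin |].
by apply: ofilt_B; have [_ -> _ _] := wstepP wu; exact: ltnW.
Qed.

Lemma edge_B c : coprod_incl c (edge K) = B c 2 1 [:: inp; inp].
Proof.
have b0 : (0 < 2)%N && ((count id [tuple true])%:Z == 1) by [].
rewrite incl_B (sum_delta (t := (Sub [tuple true] b0 : bamboo 2 1))) //.
  by rewrite ffunE scale1r.
move=> [[[|b [|]] // se] pe] _ /eqP[]; apply: val_inj; apply: val_inj => /=.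
by move: pe; case: b se.
Qed.

Lemma Tw_edge_B : Tw_edge K = B 1 2 1 [:: inp; inp].
Proof. exact: edge_B. Qed.

Lemma Tw_noedge_B : Tw_incl (noedge K) = B 1 2 0 [:: inp; gap; inp].
Proof.
have b0 : (0 < 2)%N && ((count id [tuple false])%:Z == 0) by [].
rewrite /Tw_incl incl_B (sum_delta (t := (Sub [tuple false] b0 : bamboo 2 0))) //.
  by rewrite ffunE scale1r.
move=> [[[|b [|]] // se] pe] _ /eqP[]; apply: val_inj; apply: val_inj => /=.
by move: pe; case: b se.
Qed.

Lemma alpha_B : alpha K = B 1 0 (- 2%:Z) [:: blk].
Proof. exact: elt_B. Qed.

Lemma edge_alpha_alpha_B : edge_alpha_alpha K = B 1 0 (-3) [:: blk; blk].
Proof.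
rewrite /edge_alpha_alpha Tw_edge_B alpha_B.
rewrite (@comp_B K 1 2 0 1 (- 2%:Z) 0 [::] [:: inp] [:: blk]) // muln0 scale1r.
rewrite (@comp_recast_B K 1 1 0 (-1) (- 2%:Z) 0 (-3) 0 [:: blk] [::] [:: blk]) //.
by rewrite muln0 scale1r.
Qed.

Lemma mu1_B : mu1 K = B 1 1 (-1) [:: blk; inp] + B 1 1 (-1) [:: inp; blk].
Proof.
rewrite /mu1 Tw_edge_B alpha_B.
rewrite (@comp_recast_B K 1 2 0 1 (- 2%:Z) 1 (-1) 0 [::] [:: inp] [:: blk]) //.
rewrite (@comp_recast_B K 1 2 0 1 (- 2%:Z) 1 (-1) 1 [:: inp] [::] [:: blk]) //.
by rewrite !muln0 !scale1r.
Qed.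

Lemma alpha_alpha_B : alpha_alpha K = B 1 0 (-4) [:: blk; gap; blk].
Proof.
rewrite /alpha_alpha Tw_noedge_B alpha_B.
rewrite (@comp_B K 1 2 0 0 (- 2%:Z) 0 [::] [:: gap; inp] [:: blk]) // muln0 scale1r.
rewrite (@comp_recast_B K 1 1 0 (-2) (- 2%:Z) 0 (-4) 0 [:: blk; gap] [::] [:: blk]) //.
by rewrite muln0 scale1r.
Qed.

Lemma twD_alpha : twD K _ _ (alpha K) = recast (edge_alpha_alpha K).
Proof.
rewrite edge_alpha_alpha_B alpha_B twD_B //= subr0.
by rewrite recast_B.
Qed.

End TwistingProperties.

(** The next lemmas pass from a word to the word with one black vertex turned into
    an input, from which it is recovered by plugging in the arity 0 element. *)
Lemma valid_recolor w0 b c w1 : valid (w0 ++ Some b :: w1) = valid (w0 ++ Some c :: w1).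
Proof.
rewrite /valid !rcons_cat !cat_path /= (path_some _ c).
by rewrite /no_two_gaps /= !orbT.
Qed.

Lemma blk_split w : (0 < num_blk w)%N -> exists w0 w1, w = w0 ++ blk :: w1.
Proof.
rewrite /num_blk -has_count => /hasP[_ /splitPr[w0 w1] /eqP ->].
by exists w0, w1.
Qed.

Lemma bideg_unplug c n d w0 w1 : bideg c n d (w0 ++ blk :: w1) ->
  bideg c n.+1 (d + (c.*2)%:Z) (w0 ++ inp :: w1).
Proof.
case/and3P=> vw /eqP <- /eqP dw; apply/and3P; split.
- by rewrite (valid_recolor _ _ true).
- by rewrite /num_inp !count_cat /=; apply/eqP; lia.
move: dw; rewrite /num_inp /num_blk /num_gap !count_cat /= => dw.
by apply/eqP; rewrite !mulnDl in dw *; lia.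
Qed.

Lemma bideg_blk c : bideg c 0 (- (c.*2)%:Z) [:: blk].
Proof. by rewrite /bideg /=; apply/eqP; rewrite mul1n; lia. Qed.

Lemma encode_bamboo_bideg c n d (e : bamboo n d) :
  bideg c n d (encode (nseq n false) (val e)) /\ num_blk (encode (nseq n false) (val e)) = 0%N.
Proof.
have /andP[n0 /eqP ce] := valP e.
have ns : nseq n false != [::] by rewrite -size_eq0 size_nseq -lt0n.
have se : size (val e) = (size (nseq n false)).-1 by rewrite size_nseq size_tuple.
have [eX eA eS _] := num_encode ns se.
rewrite /bideg eX eA eS encode_valid // !count_nseq /= mul0n mul1n eqxx; split=> //.
have := count_id_negb (val e); rewrite se size_nseq.
by rewrite -[sval e]/(val e) => ce2; apply/eqP; lia.
Qed.

Lemma bamboo_encode c n d w : bideg c n d w -> num_blk w = 0%N ->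
  exists e : bamboo n d, w = encode (nseq n false) (val e).
Proof.
move=> okw bw; have [W [E ->]] := bidegP okw bw.
have -> : val W = nseq n false :> seq bool.
  case: W {E} => W cW /=; apply: (@eq_from_nth _ false) => [|j lj].
    by rewrite size_tuple size_nseq addn0.
  rewrite nth_nseq if_same; apply: contraTF cW => Wj; rewrite -lt0n -has_count.
  by apply/hasP; exists (nth false W j) => //; apply: mem_nth.
move: E; rewrite mul0n; have : n = (n + 0)%N by rewrite addn0.
have : d = d + 0%N%:Z by rewrite addr0.
by move: (d + _) (n + 0)%N => s r es er; subst => E; exists E.
Qed.

Section Uniqueness.
Variable K : fieldType.
Local Notation Q c := (coprod (ncGerst K) c).
Local Notation B := (wbasis K).

Lemma incl_delta c n d (e : bamboo n d) :
  B c n d (encode (nseq n false) (val e)) =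
  coprod_incl c ([ffun e' => (e' == e)%:R] : ncGerst K n d).
Proof.
rewrite incl_B (sum_delta (t := e)) //; first by rewrite ffunE eqxx scale1r.
by move=> e' _ /negbTE ee; rewrite ffunE ee scale0r.
Qed.

Lemma incl_linear_ext c m p (V : lmodType K) (f g : Q c m p -> V) (nu : ncGerst K m p) :
  linear f -> linear g ->
  (forall w, bideg c m p w -> num_blk w = 0%N -> f (B c m p w) = g (B c m p w)) ->
  f (coprod_incl c nu) = g (coprod_incl c nu).
Proof.
move=> lf lg fg; rewrite incl_B !linear_for_sum //; apply: eq_bigr => e _.
by rewrite !linear_forZ // fg; have [] := encode_bamboo_bideg c e.
Qed.

Lemma B_unplug c n d w0 w1 : bideg c n d (w0 ++ blk :: w1) ->
  B c n d (w0 ++ blk :: w1) =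
  recast (ocomp (num_inp w0) (B c n.+1 (d + (c.*2)%:Z) (w0 ++ inp :: w1))
                (coprod_elt (ncGerst K) c)).
Proof.
move=> okw; rewrite elt_B comp_recast_B ?muln0 ?scale1r //.
- exact: bideg_unplug.
- exact: bideg_blk.
- lia.
- lia.
Qed.

(** The contribution of the input letters to the inner derivation by [a]. *)
Fixpoint insert_blk (V : lmodType K) (f : seq letter -> V) (w : seq letter) : V :=
  if w is l :: w' then
    (if l is Some false then f (blk :: inp :: w') + f (inp :: blk :: w') else 0)
    - insert_blk (fun u => f (l :: u)) w'
  else 0.

(** In the inner derivation by [a] the contributions of consecutive letters
    telescope, since [a l + l a] is the contribution of the letter [l] and signs
    alternate; only insertions at both ends of the word are left.  On words
    without [a], the derivation [wdiff] is the part of the inner derivation carried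
    by the gaps. *)
Lemma wdiff_insert_blk (V : lmodType K) (f : seq letter -> V) w : num_blk w = 0%N ->
  wdiff f w = f (blk :: w) - (-1) ^+ size w *: f (rcons w blk) - insert_blk f w.
Proof.
elim: w f => [|l w IH] f /=; first by rewrite scale1r subrr subr0.
move=> bw; rewrite {}IH; last by move: bw; rewrite /num_blk /=; lia.
have regroup (a b t x y : V) : a + b - x - (b - t - y) = a + t - (x - y).
  have -> : b - t - y = b - (t + y) by rewrite opprD addrA.
  by rewrite [a + b - x]addrAC -[LHS]addrA subKr addrACA opprB [y - x]addrC.
rewrite exprS mulN1r scaleNr opprK -(regroup _ (f [:: l, blk & w])); congr (_ - _).
by case: l bw => [[]|] // _; rewrite ?subrr ?subr0.
Qed.

(** Numbering the inputs from left to right reindexes the sum over the inputs by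
    the recursion on words. *)
Lemma sum_insert_blk (V : lmodType K) (f : seq letter -> V) (G : nat -> V) w :
  (forall w0 w1, w = w0 ++ inp :: w1 -> G (num_inp w0) = (-1) ^+ size w1 *:
     (f (w0 ++ blk :: inp :: w1) + f (w0 ++ inp :: blk :: w1))) ->
  \sum_(i < num_inp w) G i = (-1) ^+ (size w).+1 *: insert_blk f w.
Proof.
elim: w f G => [|l w IH] f G Gw; first by rewrite /num_inp big_ord0 scaler0.
have {}IH (H : nat -> V) :
    (forall w0 w1, w = w0 ++ inp :: w1 -> H (num_inp w0) = G (num_inp (l :: w0))) ->
    \sum_(i < num_inp w) H i = (-1) ^+ (size w).+1 *: insert_blk (fun u => f (l :: u)) w.
  by move=> HG; apply: IH => w0 w1 ew; rewrite (HG _ _ ew) (Gw (l :: w0) w1) // ew.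
rewrite /= scalerBr [X in _ = _ - X *: _]exprS mulN1r scaleNr opprK.
case: l Gw IH => [[]|] Gw IH; rewrite ?scaler0 ?add0r; last first.
- by rewrite -(IH G).
- rewrite [num_inp _]/= /num_inp /= add1n big_ord_recl (Gw [::] w) //.
  by rewrite (IH (fun i => G i.+1)) // !exprS !mulN1r opprK.
- by rewrite -(IH G).
Qed.

(** The first composite inserts [a] at both ends, the sum inserts it on both sides
    of each input, and what is left over is [wdiff] by [wdiff_insert_blk]. *)
Lemma twD_incl m p (nu : ncGerst K m p) :
  twD K _ _ (Tw_incl nu) = recast (ocomp 0 (mu1 K) (Tw_incl nu))
    - (-1) ^+ `|p|%N *: \sum_(i < m) recast (ocomp i (Tw_incl nu) (mu1 K)).
Proof.
pose f (x : Tw K m p) := twD K m p x.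
pose g (x : Tw K m p) : Tw K m (p - 1) := recast (ocomp 0 (mu1 K) x)
    + (- (-1) ^+ `|p|%N) *: \sum_(i < m) recast (ocomp i x (mu1 K)).
rewrite -scaleNr -[LHS]/(f (coprod_incl 1 nu)) -[RHS]/(g (coprod_incl 1 nu)).
apply: incl_linear_ext; first exact: linear_twD.
  apply: linear_for_add.
    exact: recast_ocompPr.
  apply: linear_for_scale; apply: linear_for_bigsum => i _.
  exact: recast_ocompPl.
move=> w okw bw; rewrite /f /g twD_B // wdiff_insert_blk // mu1_B.
have [vw mw] : valid w /\ num_inp w = m by case/and3P: okw => vw /eqP.
have w0 : (0 < size w)%N by case: (w) vw.
have lcl : linear (fun x : Tw K 1 (-1) => recast (ocomp 0 x (B 1 m p w)) : Tw K m (p - 1)).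
  exact: recast_ocompPl.
have lcr i : linear (fun y : Tw K 1 (-1) => recast (ocomp i (B 1 m p w) y) : Tw K m (p - 1)).
  exact: recast_ocompPr.
have -> : recast (ocomp 0 (B 1 1 (-1) [:: blk; inp] + B 1 1 (-1) [:: inp; blk]) (B 1 m p w))
  = B 1 m (p - 1) (blk :: w) - (-1) ^+ size w *: B 1 m (p - 1) (rcons w blk).
  rewrite (linear_forD _ _ lcl).
  rewrite (@comp_recast_B K 1 1 m (-1) p m (p - 1) 0 [:: blk] [::] w) //; last lia.
  rewrite (@comp_recast_B K 1 1 m (-1) p m (p - 1) 0 [::] [:: blk] w) //; last lia.
  rewrite mul0n scale1r cats0 cats1 mul1n -scaleNr; congr (_ + _ *: _).
  by case: (size w) w0 => // k _; rewrite exprS mulN1r opprK.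
pose G i : Tw K m (p - 1) :=
  recast (ocomp i (B 1 m p w) (B 1 1 (-1) [:: blk; inp] + B 1 1 (-1) [:: inp; blk])).
rewrite -[X in _ + _ *: X]/(\sum_(i < m) G i).
have -> : \sum_(i < m) G i = (-1) ^+ (size w).+1 *: insert_blk (B 1 m (p - 1)) w.
  rewrite -(@sum_insert_blk _ _ G) ?mw // => u0 u1 ew.
  rewrite /G (linear_forD _ _ (lcr _)).
  have okw' := okw; rewrite ew in okw'.
  rewrite ew.
  rewrite (@comp_recast_B K 1 m 1 p (-1) m (p - 1)) //; last by rewrite addn1.
  rewrite (@comp_recast_B K 1 m 1 p (-1) m (p - 1)) //; last by rewrite addn1.
  by rewrite muln1 scalerDr.
congr (_ + _); rewrite scalerA -scaleN1r; congr (_ *: _).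
rewrite mulNr -exprD; congr (- _); rewrite -signr_odd oddD (bideg_odd okw).
by case: (size w) w0 => // k _; rewrite /= negbK addbb.
Qed.

Lemma twD_is_twisting : is_twisting_differential (twD K).
Proof.
split.
- split; first by move=> *; exact: twD_deriv.
  by move=> *; exact: twD_filt.
- exact: twD_alpha.
- by move=> *; exact: twD_incl.
- by move=> *; exact: twD_twD.
Qed.

Lemma recast_natural (P R : ns_operad K) (F : int -> int)
  (g : forall n d, {linear P n d -> R n (F d)})
  m n p q (x : P m p) : m = n -> p = q ->
  g n q (recast x) = recast (g m p x).
Proof. by move=> em ep; subst; rewrite !recast_id. Qed.

(** By induction on the number of black vertices: [alpha] can be unplugged from a
    word with a black vertex, and the derivation rule applies; a word with no black
    vertex comes from a bamboo, for which the differential is prescribed. *)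
Lemma twD_unique (D' : forall n d, {linear Tw K n d -> Tw K n (d - 1)}) :
  is_twisting_differential D' -> forall n d x, D' n d x = twD K n d x.
Proof.
case=> [[D'deriv _] D'alpha D'incl _] n d x.
apply: (@Q_linear_ext K 1 n d _ (D' n d) (twD K n d)) => // {x}.
- exact: linearP.
- exact: linear_twD.
move=> w; move: {2}(num_blk w) (erefl (num_blk w)) => k.
elim: k n d w => [|k IH] n d w bw okw.
  have [e ->] := bamboo_encode okw bw.
  by rewrite incl_delta -!/(Tw_incl _) D'incl twD_incl.
have [|w0 [w1 ew]] := @blk_split w; first by rewrite bw.
subst w; rewrite B_unplug //.
rewrite (@recast_natural (Tw K) (Tw K) (fun d => d - 1) D')
  ?(@recast_natural (Tw K) (Tw K) (fun d => d - 1) (twD K)); try lia.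
have lti : (num_inp w0 < n.+1)%N.
  by have /and3P[_ /eqP <- _] := okw; rewrite /num_inp count_cat; lia.
have oku := bideg_unplug okw.
set x := B 1 _ _ (w0 ++ inp :: w1).
have ex : D' _ _ x = twD K _ _ x.
  by apply: IH => //; move: bw; rewrite /num_blk !count_cat /=; lia.
have eD := D'deriv _ _ _ _ _ x (alpha K) lti.
rewrite ex D'alpha -twD_alpha -(twD_deriv x (alpha K) lti) in eD.
by congr recast; exact: eD.
Qed.

End Uniqueness.

(** * The suboperad generated by the edge *)

Section SubOperad.
Variables (K : fieldType) (P : ns_operad K) (S : forall n d, submodule (P n d)).
Hypothesis operadS : is_suboperad (fun n d => smem (S n d)).
Local Notation SP := (sub_operad S).

Lemma val_sub_linear n d : linear (fun x : SP n d => val x : P n d).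
Proof. by []. Qed.

Lemma val_sub_unit : val (ounit SP) = ounit P.
Proof. by case: operadS => _ u _; rewrite val_insubd u. Qed.

Lemma val_sub_ocomp m n p q i (x : SP m p) (y : SP n q) : (i < m)%N ->
  val (ocomp i x y : SP _ _) = ocomp i (val x) (val y).
Proof.
by case: operadS => _ _ c lti; rewrite val_insubd c //; exact: valP.
Qed.

Lemma val_recast m n p q (x : SP m p) :
  val (recast x : SP n q) = recast (val x).
Proof.
rewrite /recast; case: eqP => [e|//]; case: eqP => [e'|//].
by subst.
Qed.
End SubOperad.

Section ShAs.
Variable K : fieldType.

(** Combinations of connected bamboos. *)
Definition connected_support n d : {pred ncGerst K n d} :=
  fun f => `[< forall e : bamboo n d, ~~ all id (val e) -> f e = 0 >].

Lemma connected_support_suboperad : is_suboperad connected_support.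
Proof.
split.
- move=> n d; split; first by apply/asboolP => e _; rewrite ffunE.
  move=> a f g /asboolP f0 /asboolP g0; apply/asboolP => e ne.
  by rewrite !ffunE f0 // g0 // scaler0 addr0.
- apply/asboolP => -[[[|]] //].
move=> m n p q i f g lti /asboolP f0 /asboolP g0; apply/asboolP => e ne.
rewrite ffunE big1 // => e1 _; rewrite big1 // => e2 /eqP ee.
have [a1|n1] := boolP (all id (val e1)); last by rewrite f0 // mulr0 mul0r.
have [a2|n2] := boolP (all id (val e2)); last by rewrite g0 // mulr0.
case/negP: ne; rewrite -ee /graft_edges !all_cat a2 /=.
by rewrite -all_cat cat_take_drop.
Qed.

Lemma full_bamboo n (e : bamboo n.+1 n%:Z) : val e = nseq n true :> seq bool.
Proof.
have /andP[_ /eqP [ce]] := valP e.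
have se : size (val e) = n by rewrite size_tuple.
apply: (@eq_from_nth _ true) => [|j]; rewrite ?size_nseq // se => lj.
rewrite nth_nseq lj; have : all id (val e) by rewrite all_count ce se.
by move/all_nthP; apply; rewrite se.
Qed.

Lemma connected_unique n (e e' : bamboo n.+1 n%:Z) : e = e'.
Proof. by do 2 apply: val_inj; rewrite /= !full_bamboo. Qed.

Fact connected_subproof n : (0 < n.+1)%N && ((count id (nseq_tuple n true))%:Z == n%:Z).
Proof. by rewrite /= count_nseq mul1n eqxx. Qed.

Definition connected n : bamboo n.+1 n%:Z := Sub (nseq_tuple n true) (connected_subproof n).

Lemma is_suboperad_recast (P : ns_operad K) (S : forall n d, {pred P n d}) m n p q (x : P m p) :
  m = n -> p = q -> x \in S m p -> (recast x : P n q) \in S n q.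
Proof. by move=> em ep; subst; rewrite recast_id. Qed.

(** Connected bamboos form a suboperad containing the generator.  Conversely the
    connected bamboo with [k + 2] vertices is obtained, with sign +, by plugging the
    edge into the last vertex of the one with [k + 1] vertices. *)
Lemma shAs_memP n d (f : ncGerst K n d) :
  reflect (forall e : bamboo n d, ~~ all id (val e) -> f e = 0) (f \in smem (shAs_sub K n d)).
Proof.
apply: (iffP idP) => [/asboolP/(_ connected_support)|f0].
  move/(_ connected_support_suboperad) => H; apply/asboolP; apply: H => n' d' y [].
  by apply/asboolP => -[[[|b [|]] // se] pe]; move: pe; case: b se.
apply/asboolP => S opS Sedge; case: (opS) => closedS unitS compS.
have full k : ([ffun=> 1] : ncGerst K k.+1 k%:Z) \in S k.+1 k%:Z.
  elim: k => [//|k IH].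
  have := compS _ _ _ _ k _ _ (ltnSn k) IH (Sedge _ _ _ (IsEdge K)).
  move=> /(@is_suboperad_recast _ S _ k.+2 _ k.+1%:Z).
  have en : (k.+1 + 2).-1 = k.+2 by lia.
  have ek : k%:Z + 1 = k.+1%:Z by lia.
  move/(_ en ek); set z := recast _; suff -> : z = [ffun=> 1] by [].
  apply/ffunP => E; rewrite [RHS]ffunE /z.
  rewrite recast_ncGerst_compE // (sum_delta (t := connected k)) //; last first.
    by move=> e _; rewrite (connected_unique e (connected k)) eqxx.
  rewrite (sum_delta (t := connected 1)) //; last first.
  - by move=> e _; rewrite (connected_unique e (connected 1)) eqxx.
  - rewrite (full_bamboo E) (full_bamboo (connected k)) /graft_edges.
    rewrite take_oversize ?drop_oversize ?size_nseq //.
    by rewrite -[[:: true] ++ [::]]/(nseq 1 true) -nseqD addn1.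
  by rewrite !ffunE /graft_sign drop_oversize ?size_nseq // mul0n !mulr1.
have [[e0 a0]|ne] := pselect (exists e0 : bamboo n d, all id (val e0)); last first.
  suff -> : f = 0 by case: (closedS n d).
  by apply/ffunP => e; rewrite ffunE f0 //; apply/negP => ae; case: ne; exists e.
have /andP[n0 /eqP dn] := valP e0.
have [k [en ed]] : exists k, n = k.+1 /\ d = k%:Z.
  exists n.-1; rewrite prednK //; split=> //.
  by rewrite -dn; congr Posz; move: a0; rewrite all_count size_tuple => /eqP.
subst n d; have -> : f = f e0 *: [ffun=> 1].
  by apply/ffunP => e; rewrite !ffunE (connected_unique e e0); symmetry; exact: mulr1.
have [S0 SP] := closedS k.+1 k%:Z.
by rewrite -[_ *: _]addr0; exact: SP.
Qed.

End ShAs.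

Section Embedding.
Variable K : fieldType.
Local Notation Q c := (coprod (ncGerst K) c).
Local Notation B := (wbasis K).
Local Notation G := (shAs_gamma K).

Lemma generated_suboperadP (P : ns_operad K) (X : forall n d, set (P n d)) :
  is_suboperad (fun n d => smem (generated_suboperad X n d)).
Proof.
split.
- move=> n d; exact: suboperad_mem_closed.
- by apply/asboolP => S [].
move=> m n p q i x y lti /asboolP Sx /asboolP Sy; apply/asboolP => S opS XS.
by case: (opS) => _ _; apply=> //; [exact: Sx | exact: Sy].
Qed.

Lemma shAs_suboperad : is_suboperad (fun n d => smem (shAs_sub K n d)).
Proof. exact: generated_suboperadP. Qed.

(** Forgetting that the components lie in the suboperad embeds [shAs_gamma] into a
    completed coproduct of the whole of [ncGerst], where words are available.  The
    words obtained are those without gap. *)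
Definition emb n d (x : G n d) : Q 2 n d := fun k => [ffun W => val (x k W)].

Lemma emb_linear n d : linear (@emb n d).
Proof.
move=> a x y; apply: Q_ext => k W E; congr (fun_of_fin _ E).
rewrite [RHS](coprod_linE a (emb x) (emb y)) [emb x k W]ffunE [emb y k W]ffunE [LHS]ffunE.
exact: (congr1 val (coprod_linE a x y W)).
Qed.

Lemma emb_inj n d : injective (@emb n d).
Proof.
move=> x y exy; apply: functional_extensionality_dep => k; apply/ffunP => W.
by apply: val_inj; have := congr1 (fun z : Q 2 n d => z k W) exy; rewrite !ffunE.
Qed.

Lemma emb_ocomp m n p q i (x : G m p) (y : G n q) : (i < m)%N ->
  emb (ocomp i x y) = ocomp i (emb x) (emb y).
Proof.
move=> lti; apply: Q_ext => k W E; congr (fun_of_fin _ E).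
rewrite ffunE !coprod_ocompE.
rewrite (linear_for_sum _ _ _ (@val_sub_linear _ _ (shAs_sub K) _ _)); apply: eq_bigr => j _.
rewrite (linear_for_sum _ _ _ (@val_sub_linear _ _ (shAs_sub K) _ _)); apply: eq_bigr => u _.
rewrite (linear_for_sum _ _ _ (@val_sub_linear _ _ (shAs_sub K) _ _)); apply: eq_bigr => v _.
have ltp : (input_pos i (val u) < m + j)%N.
  have cu : count negb (val u) = m.
    have := count_id_negb (val u); rewrite (eqP (valP u)) size_tuple; lia.
  have := @input_posP i (val u); rewrite cu => /(_ lti)[u0 [u1 [eu _ ->]]].
  by have := size_tuple (val u); rewrite eu size_cat /=; lia.
by rewrite val_recast (val_sub_ocomp shAs_suboperad) // !ffunE.
Qed.

Lemma emb_incl n d (x : shAs K n d) : emb (coprod_incl 2 x) = coprod_incl 2 (val x).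
Proof.
apply: Q_ext => k W E; congr (fun_of_fin _ E).
by rewrite !ffunE val_recast.
Qed.

Lemma emb_elt : emb (coprod_elt (shAs K) 2) = coprod_elt (ncGerst K) 2.
Proof.
apply: Q_ext => k W E; congr (fun_of_fin _ E).
by rewrite !ffunE val_recast (val_sub_unit shAs_suboperad).
Qed.

Lemma emb_unit : emb (ounit G) = ounit (Q 2).
Proof. by rewrite /= emb_incl (val_sub_unit shAs_suboperad). Qed.

Lemma emb_ofilt p n d (x : G n d) : ofilt p x <-> ofilt p (emb x).
Proof. by split=> H k W; have := H k W; rewrite ?ffunE. Qed.

Lemma emb_supp n d (x : G n d) k (W : word n k) (E : bamboo (n + k) (d + (k * 2.*2)%N%:Z)) :
  num_gap (encode (val W) (val E)) != 0%N -> emb x k W E = 0.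
Proof.
have u0 : (val W : seq bool) != [::].
  by have /andP[nk _] := valP E; rewrite -size_eq0 size_tuple -lt0n.
have se1 : size (val E) = (size (val W)).-1 by rewrite !size_tuple.
have [_ _ -> _] := num_encode u0 se1 => gE.
rewrite ffunE; have /shAs_memP := valP (x k W); apply.
by move: gE; rewrite -lt0n -has_count has_predC.
Qed.

Definition conn_bideg n d w := bideg 2 n d w && (num_gap w == 0%N).

(** For a word without gap, [insubd] applies to an element of the suboperad; see
    [emb_Bs]. *)
Definition conn_basis n d w : G n d := fun k => [ffun W => insubd 0 (B 2 n d w k W)].

Lemma emb_Bs n d w : num_gap w = 0%N -> emb (conn_basis n d w) = B 2 n d w.
Proof.
move=> gw; apply: Q_ext => k W E; congr (fun_of_fin _ E); rewrite !ffunE.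
rewrite val_insubd; case: ifP => // /negP[]; apply/shAs_memP => e ne.
rewrite !ffunE; have [ew|//] := eqVneq (encode (val W) (val e)) w.
have u0 : (val W : seq bool) != [::].
  by have /andP[nk _] := valP E; rewrite -size_eq0 size_tuple -lt0n.
have se1 : size (val e) = (size (val W)).-1 by rewrite !size_tuple.
have [_ _ eg _] := num_encode u0 se1; rewrite ew gw in eg.
by case/negP: ne; rewrite all_count -[X in _ == X](count_id_negb (val e)) -eg addn0.
Qed.

Definition conn_lin_ext n d (V : lmodType K) (f : seq letter -> V) (x : G n d) : V :=
  lin_ext f (emb x).

Lemma conn_lin_ext_linear n d (V : lmodType K) f : linear (@conn_lin_ext n d V f).
Proof.
exact: (linear_for_comp (lin_ext_is_linear f) (@emb_linear n d)).
Qed.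

Lemma conn_lin_ext_Bs n d (V : lmodType K) f w :
  conn_bideg n d w -> @conn_lin_ext n d V f (conn_basis n d w) = f w.
Proof. by case/andP=> okw /eqP gw; rewrite /conn_lin_ext emb_Bs // lin_ext_B. Qed.

Lemma conn_lin_ext_ext n d (V : lmodType K) f g (x : G n d) :
  (forall w, conn_bideg n d w -> f w = g w) -> conn_lin_ext f x = conn_lin_ext g x :> V.
Proof.
move=> fg; do 3 (apply: eq_bigr => ? _).
set w := encode _ _; have [gw|gw] := eqVneq (num_gap w) 0%N.
  by rewrite fg // /conn_bideg (encode_bideg _ _).1 gw.
by rewrite emb_supp // !scale0r.
Qed.

Lemma conn_lin_ext_id n d (x : G n d) : conn_lin_ext (conn_basis n d) x = x.
Proof.
apply: emb_inj; rewrite /conn_lin_ext (lin_ext_lin _ _ (@emb_linear n d)).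
rewrite -[RHS](lin_ext_id (emb x)) //; apply: conn_lin_ext_ext => w /andP[_ /eqP gw].
exact: emb_Bs.
Qed.

Lemma G_linear_ext n d (V : lmodType K) (f g : G n d -> V) :
  linear f -> linear g ->
  (forall w, conn_bideg n d w -> f (conn_basis n d w) = g (conn_basis n d w)) ->
  forall x, f x = g x.
Proof.
move=> lf lg fg x; rewrite -(conn_lin_ext_id x) /conn_lin_ext !lin_ext_lin //.
exact: conn_lin_ext_ext.
Qed.

End Embedding.

(** * The comparison map *)

(** The substitution [gamma -> a s a].  Since [a s a] has odd length, it changes
    neither the parity of lengths nor, consequently, the signs of [comp_B]. *)
Definition double_blk (w : seq letter) : seq letter :=
  flatten [seq if l is Some true then [:: blk; gap; blk] else [:: l] | l <- w].

Lemma double_blk_cat u v : double_blk (u ++ v) = double_blk u ++ double_blk v.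
Proof. by rewrite /double_blk map_cat flatten_cat. Qed.

Lemma num_double_blk w : [/\ num_inp (double_blk w) = num_inp w,
  num_blk (double_blk w) = (num_blk w).*2,
  num_gap (double_blk w) = (num_gap w + num_blk w)%N &
  size (double_blk w) = (size w + (num_blk w).*2)%N].
Proof.
rewrite /num_inp /num_blk /num_gap; elim: w => //= l w [].
by rewrite /double_blk /=; case: l => [[]|] /= -> -> -> ->; split; lia.
Qed.

Lemma double_blk_bideg n d w : conn_bideg n d w -> bideg 1 n d (double_blk w).
Proof.
case/andP=> /and3P[vw /eqP nw /eqP dw] /eqP gw.
have [eX eA eS _] := num_double_blk w.
apply/and3P; split; last by rewrite eX eA eS gw; apply/eqP; lia.
  have: w != [::] by case: (w) vw.
  move=> {vw nw dw eX eA eS}; rewrite /valid.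
  have pc c : path no_two_gaps (Some c) (rcons (double_blk w) gap).
    elim: w c gw => [//|l w IH] c; rewrite /num_gap /= => gw.
    by case: l gw => [[]|] //= gw; rewrite ?(IH true) ?(IH false).
  by case: w gw pc => [|[[]|] w] //= _ /(_ true) .
by rewrite eX nw.
Qed.

Section Comparison.
Variable K : fieldType.
Local Notation B := (wbasis K).
Local Notation Bs := (conn_basis K).
Local Notation G := (shAs_gamma K).

Lemma G_ocompPl m n p q i (y : G n q) : (i < m)%N ->
  linear (fun x : G m p => ocomp i x y).
Proof.
move=> lti a x x'; apply: emb_inj.
refine (etrans (emb_ocomp _ y lti) (etrans _ (esym (emb_linear a _ _)))).
refine (etrans (congr1 (fun z => ocomp i z (emb y)) (emb_linear a x x')) _).
refine (etrans (ocompPl i (emb y) a (emb x) (emb x')) _).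
exact: (congr2 (fun u v => a *: u + v) (esym (emb_ocomp x y lti)) (esym (emb_ocomp x' y lti))).
Qed.

Lemma G_ocompPr m n p q i (x : G m p) : (i < m)%N ->
  linear (fun y : G n q => ocomp i x y).
Proof.
move=> lti a y y'; apply: emb_inj.
refine (etrans (emb_ocomp x _ lti) (etrans _ (esym (emb_linear a _ _)))).
refine (etrans (congr1 (ocomp i (emb x)) (emb_linear a y y')) _).
refine (etrans (ocompPr i (emb x) a (emb y) (emb y')) _).
exact: (congr2 (fun u v => a *: u + v) (esym (emb_ocomp x y lti)) (esym (emb_ocomp x y' lti))).
Qed.

Lemma num_inp_lt c m p w0 w1 : bideg c m p (w0 ++ inp :: w1) -> (num_inp w0 < m)%N.
Proof. by case/and3P=> _ /eqP <- _; rewrite /num_inp count_cat /=; lia. Qed.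

Lemma conn_bideg_graft m n p q w0 w1 v :
  conn_bideg m p (w0 ++ inp :: w1) -> conn_bideg n q v ->
  conn_bideg (m + n).-1 (p + q) (w0 ++ v ++ w1).
Proof.
case/andP=> okw /eqP gw /andP[okv /eqP gv]; rewrite /conn_bideg (bideg_graft okw okv) /=.
by move: gw gv; rewrite /num_gap !count_cat /=; lia.
Qed.

Lemma comp_Bs m n p q i w0 w1 v :
  conn_bideg m p (w0 ++ inp :: w1) -> conn_bideg n q v -> i = num_inp w0 ->
  ocomp i (Bs m p (w0 ++ inp :: w1)) (Bs n q v) =
    (-1) ^+ (size w1 * (size v).-1) *: Bs (m + n).-1 (p + q) (w0 ++ v ++ w1).
Proof.
move=> okw okv ei; have := conn_bideg_graft okw okv => /andP[_ /eqP gg].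
case/andP: okw => okw /eqP gw; case/andP: okv => okv /eqP gv.
apply: emb_inj; rewrite (linear_forZ _ _ (@emb_linear K _ _)) emb_ocomp.
  by rewrite !emb_Bs // comp_B.
by rewrite ei; exact: num_inp_lt okw.
Qed.

Lemma comp_recast_Bs m n p q r s i w0 w1 v :
  conn_bideg m p (w0 ++ inp :: w1) -> conn_bideg n q v -> i = num_inp w0 ->
  r = (m + n).-1 -> s = p + q ->
  recast (ocomp i (Bs m p (w0 ++ inp :: w1)) (Bs n q v)) =
    (-1) ^+ (size w1 * (size v).-1) *: Bs r s (w0 ++ v ++ w1).
Proof. by move=> *; subst; rewrite recast_id comp_Bs. Qed.

Lemma edge_Bs : shAs_gamma_edge K = Bs 2 1 [:: inp; inp].
Proof.
apply: emb_inj; rewrite emb_Bs // -edge_B emb_incl; congr coprod_incl.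
rewrite val_insubd ifT //; apply/asboolP => S _; apply; exact: IsEdge.
Qed.

Lemma gamma_Bs : gamma K = Bs 0 (- 4%:Z) [:: blk].
Proof. by apply: emb_inj; rewrite emb_Bs // emb_elt elt_B. Qed.

Lemma unit_Bs : ounit G = Bs 1 0 [:: inp].
Proof. by apply: emb_inj; rewrite emb_Bs // emb_unit unit_B. Qed.

Definition comparison n d (x : G n d) : Tw K n d :=
  conn_lin_ext (fun w => B 1 n d (double_blk w)) x.

HB.instance Definition _ n d :=
  GRing.isLinear.Build K (G n d) (Tw K n d) *:%R (@comparison n d)
    (conn_lin_ext_linear (fun w => B 1 n d (double_blk w))).

Definition phi n d : {linear G n d -> Tw K n d} := @comparison n d.

Lemma phi_Bs n d w : conn_bideg n d w -> phi n d (Bs n d w) = B 1 n d (double_blk w).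
Proof. by move=> okw; rewrite /phi /= /comparison conn_lin_ext_Bs. Qed.

Lemma phi_linear n d : linear (phi n d).
Proof. by move=> a x y; exact: linearP. Qed.

Lemma phi_ocomp m n p q i (x : G m p) (y : G n q) : (i < m)%N ->
  phi _ _ (ocomp i x y) = ocomp i (phi _ _ x) (phi _ _ y).
Proof.
move=> lti; move: x; apply: G_linear_ext.
- exact: (linear_for_comp (@phi_linear _ _) (@G_ocompPl m n p q i y lti)).
- exact: (linear_for_comp (@ocompPl K 1 m n p q i _) (@phi_linear m p)).
move=> w okw; move: y; apply: G_linear_ext.
- exact: (linear_for_comp (@phi_linear _ _) (@G_ocompPr m n p q i _ lti)).
- exact: (linear_for_comp (@ocompPr K 1 m n p q i _) (@phi_linear n q)).
move=> v okv.
have [w0 [w1 [ew iw]]] : exists w0 w1, w = w0 ++ inp :: w1 /\ i = num_inp w0.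
  by apply: inp_split; case/andP: okw => /and3P[_ /eqP ->].
subst w; rewrite comp_Bs // linear_forZ; last exact: phi_linear.
rewrite !phi_Bs //; last exact: conn_bideg_graft.
have := double_blk_bideg okw; rewrite !double_blk_cat [double_blk (_ :: _)]/= => okd.
rewrite comp_B //; last by have [-> _ _ _] := num_double_blk w0.
  congr (_ *: _); apply: eq_sign; rewrite !oddM.
  have v0 : (0 < size v)%N by case/andP: okv => /and3P[]; case: (v).
  have [_ _ _ ->] := num_double_blk w1; have [_ _ _ ->] := num_double_blk v.
  by lia.
exact: double_blk_bideg.
Qed.

Lemma phi_filt p n d (x : G n d) : ofilt p x -> ofilt p (phi n d x).
Proof.
move=> /emb_ofilt; apply: lin_ext_filt => [|a u v|w _ pw]; [exact: ofilt0 | exact: ofilt_lin |].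
apply: ofilt_B; have [_ -> _ _] := num_double_blk w.
by rewrite -addnn; exact: leq_trans pw (leq_addr _ _).
Qed.

(** The word [a s a] is closed: [aasa - a(as + sa)a + asaa = 0]. *)
Lemma phi_cycle n d (x : G n d) : twD K _ _ (phi n d x) = 0.
Proof.
move: x; apply: G_linear_ext => [||w okw].
- exact: (linear_for_comp (@linear_twD K n d) (@phi_linear n d)).
- by move=> a x y; rewrite scaler0 addr0.
rewrite phi_Bs // twD_B; last exact: double_blk_bideg.
case/andP: okw => _; elim: w (B 1 n (d - 1)) => [//|l w IH] f.
rewrite /num_gap /= => gw; case: l gw => [[]|] //= gw; rewrite -/(double_blk w).
  by rewrite IH // subr0 opprB addrA subrr.
by rewrite IH // subr0.
Qed.

Lemma phi_comparison : is_comparison (twD K) phi.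
Proof.
split.
- split.
  + by rewrite unit_Bs phi_Bs // unit_B.
  + by move=> *; exact: phi_ocomp.
  + by move=> *; exact: phi_filt.
- by move=> *; exact: phi_cycle.
- by rewrite edge_Bs phi_Bs // Tw_edge_B.
- by rewrite gamma_Bs phi_Bs // alpha_alpha_B.
Qed.

Lemma conn_bideg_unplug n d w0 w1 : conn_bideg n d (w0 ++ blk :: w1) ->
  conn_bideg n.+1 (d + 4) (w0 ++ inp :: w1).
Proof.
move=> /andP[okw gw]; rewrite /conn_bideg (@bideg_unplug 2) //.
by move: gw; rewrite /num_gap !count_cat.
Qed.

Lemma all_inp w : num_blk w = 0%N -> num_gap w = 0%N -> w = nseq (num_inp w) inp.
Proof.
rewrite /num_blk /num_gap /num_inp; elim: w => [//|[[]|] w IH] //= b0 g0.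
by rewrite {1}(IH b0 g0).
Qed.

Lemma conn_bideg_nseq n d : conn_bideg n d (nseq n inp) -> (0 < n)%N /\ d = n.-1%:Z.
Proof.
case/andP=> /and3P[vw _ /eqP]; rewrite /num_inp /num_blk /num_gap !count_nseq /= => dw _.
case: n vw dw => [//|n] _ dw; split=> //=; lia.
Qed.

Lemma chain_bideg n : conn_bideg n.+1 n%:Z (nseq n.+1 inp).
Proof.
rewrite /conn_bideg /bideg /num_inp /num_blk /num_gap !count_nseq /= !mul0n mul1n eqxx andbT.
apply/andP; split; last by apply/eqP; lia.
by rewrite /valid /=; elim: n.
Qed.

Lemma chain_S n : Bs n.+2 n.+1%:Z (nseq n.+2 inp) =
  recast (ocomp n (Bs n.+1 n%:Z (nseq n.+1 inp)) (shAs_gamma_edge K)).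
Proof.
have e : nseq n.+1 inp = nseq n inp ++ [:: inp].
  by rewrite -[[:: inp]]/(nseq 1 inp) -nseqD addn1.
have ok1 := chain_bideg n; rewrite edge_Bs e in ok1 *.
rewrite comp_recast_Bs //; first last.
- lia.
- lia.
- by rewrite /num_inp count_nseq mul1n.
rewrite mul0n scale1r cats0; congr Bs.
by rewrite -[[:: inp; inp]]/(nseq 2 inp) -nseqD addn2.
Qed.

Lemma Bs_unplug n d w0 w1 : conn_bideg n d (w0 ++ blk :: w1) ->
  Bs n d (w0 ++ blk :: w1) =
  recast (ocomp (num_inp w0) (Bs n.+1 (d + 4) (w0 ++ inp :: w1)) (gamma K)).
Proof.
move=> /andP[okw gw]; rewrite gamma_Bs comp_recast_Bs ?muln0 ?scale1r //.
- by apply: conn_bideg_unplug; rewrite /conn_bideg okw.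
- lia.
- lia.
Qed.

(** By induction on the number of letters [gamma], then on the length: words are
    composites of [gamma], the edge and the unit. *)
Lemma phi_unique (phi' : forall n d, {linear G n d -> Tw K n d}) :
  is_comparison (twD K) phi' -> forall n d x, phi' n d x = phi n d x.
Proof.
case=> [[phi'1 phi'M _] _ phi'e phi'g] n d x.
have [[phi1 phiM _] _ phie phig] := phi_comparison.
apply: (@G_linear_ext K n d _ (phi' n d) (phi n d)) => // {x}.
- exact: linearP.
- exact: phi_linear.
move=> w; move: {2}(num_blk w) (erefl (num_blk w)) => k.
elim: k n d w => [|k IH] n d w bw okw; last first.
  have [|w0 [w1 ew]] := @blk_split w; first by rewrite bw.
  subst w; rewrite Bs_unplug //.
  rewrite (@recast_natural K _ _ id phi') ?(@recast_natural K _ _ id phi); try lia.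
  have oku : conn_bideg n.+1 (d + 4) (w0 ++ inp :: w1).
    exact: conn_bideg_unplug.
  have lti := num_inp_lt (proj1 (andP oku)).
  congr recast; rewrite phi'M // phiM // phi'g phig IH //.
  by move: bw; rewrite /num_blk !count_cat /=; lia.
have ew : w = nseq n inp.
  by case/andP: (okw) => /and3P[_ /eqP <- _] /eqP gw; apply: all_inp.
subst w; have [n0 ed] := conn_bideg_nseq okw; subst d; case: n n0 {bw okw} => // n _ /=.
elim: n => [|n IH]; first by rewrite -unit_Bs phi'1 phi1.
rewrite chain_S (@recast_natural K _ _ id phi') ?(@recast_natural K _ _ id phi); try lia.
by rewrite phi'M // phiM // phi'e phie IH.
Qed.

End Comparison.

(** * Contracting the runs of black vertices *)

Section Homotopy.
Variable K : fieldType.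

Definition run (w : seq letter) := find (predC (pred1 blk)) w.
Definition after_run (w : seq letter) := ohead (drop (run w) w).

Lemma run_nseq k u : ohead u != Some blk -> run (nseq k blk ++ u) = k.
Proof.
move=> u0; rewrite /run; elim: k => [|k IH] /=; last by rewrite IH.
by case: u u0 => [|[[]|] u].
Qed.

Lemma after_run_nseq k u : ohead u != Some blk -> after_run (nseq k blk ++ u) = ohead u.
Proof. by move=> u0; rewrite /after_run run_nseq // drop_size_cat // size_nseq. Qed.

Lemma run_split w : exists k u, w = nseq k blk ++ u /\ ohead u != Some blk.
Proof.
elim: w => [|l w [k [u [-> u0]]]]; first by exists 0%N, [::].
case: l => [[]|]; [by exists k.+1, u | |].
- by exists 0%N, (inp :: nseq k blk ++ u).
- by exists 0%N, (gap :: nseq k blk ++ u).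
Qed.

(** Whether the contraction turns [a^k] into [a^(k-1)], for a run with no gap on its
    left that is followed by the letter [r] ([None] at the end of the word).  The
    parity is the one for which [a^(k-1)] is sent to plus or minus [a^k]. *)
Definition contracts_at_start (k : nat) (r : option letter) : bool :=
  if r is Some None then odd k else ~~ odd k && (0 < k)%N.

(** The same for the run that follows an initial [a s].  At the end of the word
    the single [a] must be spared, since it gives the surviving word [a s a]. *)
Definition contracts_after_gap (k : nat) (r : option letter) : bool :=
  match r with
  | Some None => ~~ odd k && (0 < k)%N
  | Some _ => odd k
  | None => odd k && (2 < k)%N
  end.

(** The sign is that of the differential of this run: the [s] on its left
    contributes [sa], one place before the run begins. *)
Definition contract_gap (V : lmodType K) (f : seq letter -> V) (w : seq letter) : V :=
  (- (contracts_after_gap (run w) (after_run w))%:R) *: f (behead w).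

(** The homotopy, in transposed form like [wdiff].  It skips the letters [x] at the
    beginning of the word, or an initial [a s], and contracts the run of black
    vertices found there.  The flag [start] tells whether the beginning of the
    whole word has been reached or a letter [x] has just been skipped: the initial
    [a s] is special in the first case only, the run [a] being the surviving one
    there while after [x] the empty run is allowed. *)
Fixpoint contract (V : lmodType K) (start : bool) (f : seq letter -> V)
    (w : seq letter) : V :=
  match w with
  | Some false :: w' => - contract false (fun u => f (inp :: u)) w'
  | Some true :: w' =>
      if start && (run w == 1%N) && (after_run w == Some gap)
      then contract_gap (fun u => f (blk :: gap :: u)) (behead w')
      else (contracts_at_start (run w) (after_run w))%:R *: f w'
  | _ => 0
  end.

(** Consecutive terms of the derivative of [a^k] cancel, as they are equal with
    opposite signs. *)
Lemma wdiff_run (V : lmodType K) (f : seq letter -> V) k u :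
  wdiff f (nseq k blk ++ u) = (odd k)%:R *: f (nseq k.+1 blk ++ u)
    + (-1) ^+ k *: wdiff (fun v => f (nseq k blk ++ v)) u.
Proof.
elim: k f => [|k IH] f /=; first by rewrite scale0r add0r scale1r.
rewrite IH /= opprD addrA exprS mulN1r scaleNr; congr (_ - _).
by case: (odd k); rewrite ?scale1r ?scale0r ?subrr ?subr0.
Qed.

(** The homotopy on a tensor product with the complex of one run: [b] and [c] are
    the coefficients of the differential and of the contraction on the run, and
    [W] is the rest of the differential.  The terms with [W] cancel because the
    contraction changes by one the number of letters that [W] moves across.  The
    contraction may depend on what follows the run only through its first letter,
    which [W] preserves. *)
Lemma block_homotopy (V : lmodType K) (D H : (seq letter -> V) -> seq letter -> V)
    (W : (seq letter -> V) -> V) (b c : nat -> K) j r (f : seq letter -> V) :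
  (forall F k, D F (nseq k blk ++ r) =
     b k *: F (nseq k.+1 blk ++ r) + (-1) ^+ k *: W (fun u => F (nseq k blk ++ u))) ->
  (forall F k u, ohead u = ohead r -> (j <= k)%N ->
     H F (nseq k blk ++ u) = c k *: F (nseq k.-1 blk ++ u)) ->
  (forall F G, (forall u, ohead u = ohead r -> F u = G u) -> W F = W G) ->
  (forall a F, W (fun u => a *: F u) = a *: W F) ->
  c 0%N = 0 -> b j * c j.+1 + c j * b j.-1 = 1 ->
  D (H f) (nseq j blk ++ r) + H (D f) (nseq j blk ++ r) = f (nseq j blk ++ r).
Proof.
move=> DE HE Wext WZ c0 bc.
rewrite (HE (D f)) // [D (H f) _]DE (HE f j.+1) //=.
rewrite (Wext _ (fun u => c j *: f (nseq j.-1 blk ++ u))); last by move=> u ru; exact: HE.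
rewrite WZ DE; case: j HE bc => [|j] HE bc /=.
  by rewrite c0 !scale0r scaler0 !addr0 scalerA -[RHS]scale1r -bc c0 mul0r addr0.
rewrite scalerDr addrACA !scalerA -!scalerDl bc scale1r exprS.
by rewrite mulN1r mulNr mulrC addNr scale0r addr0.
Qed.

(** The part of the differential on what follows a run that does not lengthen the
    run; when a gap follows, its term [as] lengthens the run and is left out. *)
Definition wdiff_rest (V : lmodType K) (r : seq letter) (f : seq letter -> V) : V :=
  if r is None :: r' then f (gap :: blk :: r') - wdiff (fun u => f (gap :: u)) r'
  else wdiff f r.

Lemma wdiff_rest_ext (V : lmodType K) r (f g : seq letter -> V) : ohead r != Some blk ->
  (forall u, ohead u = ohead r -> f u = g u) -> wdiff_rest r f = wdiff_rest r g.
Proof.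
case: r => [|[[]|] r] //= _ fg.
  by rewrite (wdiff_ext (g := fun u => g (inp :: u))) // => u _; exact: fg.
by rewrite fg //; congr (_ - _); apply: wdiff_ext => u _; exact: fg.
Qed.

Lemma wdiff_restZ (V : lmodType K) r a (f : seq letter -> V) :
  wdiff_rest r (fun u => a *: f u) = a *: wdiff_rest r f.
Proof. by case: r => [|[b|] r]; rewrite /wdiff_rest wdiffZ // scalerBr. Qed.

(** The coefficient with which [wdiff] lengthens a run [a^k] that is followed by
    [r]; the second summand comes from the term [as] of a gap. *)
Definition block_coef (k : nat) (r : option letter) : K :=
  (odd k)%:R + (if r is Some None then (-1) ^+ k else 0).

Lemma wdiff_block (V : lmodType K) (f : seq letter -> V) k r :
  wdiff f (nseq k blk ++ r) = block_coef k (ohead r) *: f (nseq k.+1 blk ++ r)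
    + (-1) ^+ k *: wdiff_rest r (fun v => f (nseq k blk ++ v)).
Proof.
rewrite wdiff_run /block_coef; case: r => [|[b|] r] /=; rewrite ?addr0 //.
rewrite scalerDl -[RHS]addrA -[X in _ = _ + X]scalerDr [X in _ = _ + _ *: X]addrA.
congr (_ + _ *: (_ + _ - _)); rewrite -[RHS]/(f ((blk :: nseq k blk) ++ gap :: r)).
by rewrite -cat_rcons -cats1 -[[:: blk]]/(nseq 1 blk) -nseqD addn1.
Qed.

(** The homotopy identity on the part [w] of a word [a s w].  The differential of
    the prefix is [aas - a(as + sa) = - asa], which accounts for the subtracted
    terms. *)
Lemma contract_gapP (V : lmodType K) (f : seq letter -> V) w : valid w ->
  wdiff (contract_gap f) w - contract_gap f (blk :: w)
    + contract_gap (fun u => wdiff f u - f (blk :: u)) w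
  = if w == [:: blk] then 0 else f w.
Proof.
have [j [r [-> r0]]] := run_split w => vw.
have [/eqP ew|nw] := boolP (nseq j blk ++ r == [:: blk]).
  case: j ew vw => [|[|j]] //=; first by move=> ew; rewrite ew in r0.
  case: r r0 => //= _ _ _; rewrite /contract_gap /after_run /= oppr0 !scale0r.
  by rewrite !subrr add0r.
pose D (F : seq letter -> V) u := wdiff F u - F (blk :: u).
apply: (@block_homotopy V D (@contract_gap V) (wdiff_rest r)
  (fun k => block_coef k (ohead r) - 1) (fun k => - (contracts_after_gap k (ohead r))%:R) j r f).
- by move=> F k; rewrite /D wdiff_block scalerBl scale1r addrAC.
- move=> F k u ur jk; have u0 : ohead u != Some blk by rewrite ur.
  rewrite /contract_gap run_nseq // after_run_nseq // ur; case: k {jk} => //=.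
  by case: (ohead r) r0 => [[[]|]|] //= _; rewrite oppr0 !scale0r.
- by move=> F G; exact: wdiff_rest_ext.
- by move=> a F; exact: wdiff_restZ.
- by case: (ohead r) => [[[]|]|] /=; rewrite oppr0.
have sg : (-1) ^+ j = (-1) ^+ odd j :> K by rewrite signr_odd.
have sg1 : (-1) ^+ j.-1 = (-1) ^+ odd j.-1 :> K by rewrite signr_odd.
have j0 : ohead r <> Some inp -> (0 < j)%N.
  by case: (j) vw => //; case: (r) r0 => [|[[]|] r1].
have j1 : ohead r = None -> j != 1%N.
  by case: (r) nw => //= nw _; apply: contraNN nw => /eqP ->.
rewrite /block_coef /contracts_after_gap sg sg1 {sg sg1 vw nw}.
case: (ohead r) r0 j0 j1 => [[[]|]|] // _ j0 j1.
- case: (j) => [|k] /=; rewrite ?expr0; first by ring.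
  by case: (odd k) => /=; ring.
- have {j0} := j0 ltac:(done); case: (j) => // k _ /=.
  by case: (k) => [|l] /=; [|case: (odd l) => /=]; ring.
have {j0} := j0 ltac:(done); have {j1} := j1 erefl; case: (j) => // -[|k] // _ _ /=.
by case: k => [|k] /=; [|case: (odd k) => /=]; ring.
Qed.

Lemma contract_blk (V : lmodType K) st (f : seq letter -> V) w :
  contract st f (blk :: w) =
    if st && (run (blk :: w) == 1%N) && (after_run (blk :: w) == Some gap)
    then contract_gap (fun u => f (blk :: gap :: u)) (behead w)
    else (contracts_at_start (run (blk :: w)) (after_run (blk :: w)))%:R *: f w.
Proof. by []. Qed.

Lemma contractN (V : lmodType K) st (f : seq letter -> V) w :
  contract st (fun u => - f u) w = - contract st f w.
Proof.
elim: w st f => [|[[]|] w IH] st f /=; rewrite ?oppr0 //; last by rewrite IH.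
by case: ifP => _; rewrite /contract_gap scalerN.
Qed.

(** The words that span the homology. *)
Definition representative (start : bool) (w : seq letter) : bool :=
  all (pred1 inp) w || start && (w == [:: blk; gap; blk]).

(** Induction skips the letters [x].  Once a run is reached, either it is the
    initial [a s] and [contract_gapP] applies, or [block_homotopy] does; the
    coefficients to compare depend only on the parity of the run and on the next
    letter. *)
Lemma contract_homotopy (V : lmodType K) (start : bool) (f : seq letter -> V) w :
  (if start then valid w else path no_two_gaps inp (rcons w gap)) ->
  wdiff (contract start f) w + contract start (wdiff f) w =
    if representative start w then 0 else f w.
Proof.
elim: w start f => [|l w IH] st f vw; first by case: st vw; rewrite //= addr0.
have [ei|ni] := eqVneq l inp.
  have {}IH := IH false (fun u => f (inp :: u)) _; rewrite ei /= in vw *.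
  have pw : path no_two_gaps inp (rcons w gap) by case: st vw.
  rewrite sub0r -/(contract _ _ _) wdiffN opprK.
  have -> : contract false (fun u => 0 - wdiff (fun v => f (inp :: v)) u) w =
            - contract false (wdiff (fun v => f (inp :: v))) w.
    rewrite -contractN; congr contract.
    by apply: functional_extensionality_dep => u; rewrite sub0r.
  by rewrite opprK IH // /representative /= andbF orbF.
have [j [r [ew r0]]] := run_split (l :: w).
have jr : (0 < j)%N \/ ohead r = Some gap.
  case: (j) (r) r0 ew => [|k]; last by left.
  by case=> [|[[]|] r1] //=; [move=> _ [e _]; rewrite e eqxx in ni | right].
have [/and3P[st1 /eqP j1 /eqP rg]|nas] := boolP [&& st, j == 1%N & ohead r == Some gap].
  have [r1 er] : exists r1, r = gap :: r1 by case: (r) rg => // _ r1 [->]; exists r1.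
  rewrite {}ew {}er {}st1 {}j1 /= in vw *.
  have sub3 (x y z : V) : x - (x + y - z) = z - y.
    by rewrite opprB addrCA opprD addNKr.
  have -> : contract_gap (fun u => wdiff f (blk :: gap :: u)) r1 =
      contract_gap (fun u => wdiff (fun v => f (blk :: gap :: v)) u
                              - f (blk :: gap :: blk :: u)) r1.
    congr contract_gap; apply: functional_extensionality_dep => u /=.
    exact: sub3.
  have vr : valid r1 by case/andP: vw.
  have := contract_gapP (fun u => f (blk :: gap :: u)) vr.
  by rewrite sub3 /representative /= => ->.
have -> : representative st (l :: w) = false.
  rewrite /representative /= (negbTE ni) /=; apply/negP => /andP[st1 /eqP e].
  move: nas; rewrite st1 e in ew *; case: (j) ew => [|[|k]] //= [].
    by move=> e1; rewrite -e1 in r0.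
  by move=> <-.
have j0 : st -> ohead r = Some gap -> (0 < j)%N.
  move=> st1; rewrite st1 ew in vw; case: (j) vw => //.
  by case: (r) => [|[]].
rewrite -[RHS]/(f (l :: w)) ew.
apply: (@block_homotopy V (@wdiff K V) (@contract V st) (wdiff_rest r)
  (fun k => block_coef k (ohead r)) (fun k => (contracts_at_start k (ohead r))%:R) j r f).
- by move=> F k; exact: wdiff_block.
- move=> F k u ur jk; have u0 : ohead u != Some blk by rewrite ur.
  case: k jk => [|k] jk.
    have {jk} jz : j = 0%N by case: (j) jk.
    case: jr => [|rg]; first by rewrite jz.
    rewrite rg /= scale0r; rewrite rg in ur.
    by case: (u) ur => // _ u1 [->].
  have := contract_blk st F (nseq k blk ++ u).
  rewrite -[blk :: (_ ++ _)]/(nseq k.+1 blk ++ u) run_nseq // after_run_nseq // ur => ->.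
  case: ifP => // /andP[/andP[st1 /eqP[k0]] rg]; case/negP: nas.
  rewrite st1 rg eqn_leq (leq_trans jk) ?k0 //=.
  by rewrite andbT; apply: j0 => //; exact/eqP.
- by move=> F G fg; apply: (wdiff_rest_ext r0).
- by move=> a F; exact: wdiff_restZ.
- by case: (ohead r) => [[[]|]|] /=.
have sg : (-1) ^+ j = (-1) ^+ odd j :> K by rewrite signr_odd.
have sg1 : (-1) ^+ j.-1 = (-1) ^+ odd j.-1 :> K by rewrite signr_odd.
rewrite /block_coef /contracts_at_start sg sg1 {sg sg1 vw ew nas j0}.
case: (ohead r) r0 jr => [[[]|]|] // _ [] //; case: (j) => [|k] // _ /=.
- by case: (odd k) => /=; ring.
- by case: (odd k) => /=; ring.
- by ring.
- by case: (odd k) => /=; ring.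
- by case: (odd k) => /=; ring.
Qed.

End Homotopy.

Section TwHomotopy.
Variable K : fieldType.
Local Notation B := (wbasis K).

(** The contraction never produces a word that is not valid.  This matters because
    the differential of an invalid word may contain valid ones. *)
Lemma contract_gap_ext (V : lmodType K) (f g : seq letter -> V) w : valid w ->
  (forall u, valid u -> wstep (gap :: u) (gap :: w) -> f u = g u) ->
  contract_gap f w = contract_gap g w.
Proof.
case: w => [|[[]|] w] // vw fg; rewrite /contract_gap; last by rewrite /= oppr0 !scale0r.
case: w vw fg => [|[b|] w] vw fg; [by rewrite oppr0 !scale0r | | by rewrite oppr0 !scale0r].
congr (_ *: _); apply: fg => /=; last exact: (StepGapR [::]).
by move: vw; rewrite /valid /=.
Qed.

Lemma contract_ext (V : lmodType K) st (f g : seq letter -> V) w :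
  path no_two_gaps (if st then gap else inp) (rcons w gap) ->
  (forall u, path no_two_gaps (if st then gap else inp) (rcons u gap) ->
     wstep u w -> f u = g u) ->
  contract st f w = contract st g w.
Proof.
elim: w st f g => [//|[[]|] w IH] st f g pw fg //; last first.
  congr (- _); apply: IH => [|u pu uw]; first by case: (st) pw.
  by apply: fg; [case: (st) | exact: wstep_cons].
rewrite !contract_blk; case: ifP => [/andP[/andP[st1 rg] ag]|nag].
  rewrite st1 /= in pw fg; case: w pw rg ag fg {IH} => // -[[]|] //= w.
  move=> pw _ _ fg; apply: contract_gap_ext => // u vu uw.
  by apply: fg => //; exact: wstep_cons.
case: w pw fg nag {IH} => [|[[]|] w] pw fg nag.
- by rewrite !scale0r.
- congr (_ *: _); apply: fg; last exact: (StepBlk [::]).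
  by move: pw; case: (st).
- by rewrite !scale0r.
congr (_ *: _); apply: fg; last exact: (StepGapL [::]).
by move: pw nag; case: (st).
Qed.

Lemma contract_lin (V W : lmodType K) (g : V -> W) st f w : linear g ->
  g (contract st f w) = contract st (fun u => g (f u)) w.
Proof.
move=> lg; elim: w st f => [|[[]|] w IH] st f /=; rewrite ?linear_for0 //.
  by case: ifP => _; rewrite /contract_gap linear_forZ.
by rewrite -scaleN1r linear_forZ // scaleN1r IH.
Qed.

Definition tw_contract n d (x : Tw K n d) : Tw K n (d + 1) :=
  lin_ext (contract true (B 1 n (d + 1))) x.

Lemma tw_contract_linear n d : linear (@tw_contract n d).
Proof. exact: lin_ext_is_linear. Qed.

Lemma bideg_unstep n d w u : bideg 1 n d w -> valid u -> wstep u w -> bideg 1 n (d + 1) u.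
Proof.
case/and3P=> _ /eqP nw /eqP dw vu uw; have [eX eA eS _] := wstepP uw.
by apply/and3P; split; rewrite // -?eX ?nw //; apply/eqP; lia.
Qed.

(** The identity of [contract_homotopy] for [f] the family of basis elements; both
    operators are transposes, so that their order is exchanged. *)
Lemma tw_homotopy n d (x : Tw K n d) :
  recast (twD K _ _ (tw_contract x)) + recast (tw_contract (twD K _ _ x))
  = x - lin_ext (fun w => if representative true w then B 1 n d w else 0) x :> Tw K n d.
Proof.
move: x; apply: Q_linear_ext => //.
- apply: linear_for_add.
    apply: linear_for_comp; first exact: recast_linear.
    by apply: linear_for_comp; [exact: linear_twD | exact: tw_contract_linear].
  apply: linear_for_comp; first exact: recast_linear.
  by apply: linear_for_comp; [exact: tw_contract_linear | exact: linear_twD].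
- move=> a x y; rewrite linearP scalerBr opprD addrACA //.
move=> w okw; have vw : valid w by case/and3P: okw.
rewrite lin_ext_B // twD_B // /tw_contract lin_ext_B //.
have -> : recast (twD K n (d + 1) (contract true (B 1 n (d + 1)) w)) =
    contract true (wdiff (B 1 n d)) w :> Tw K n d.
  rewrite contract_lin; last exact: linear_twD.
  rewrite contract_lin; last exact: recast_linear.
  apply: contract_ext => // u vu uw.
  rewrite twD_B; last exact: bideg_unstep okw vu uw.
  rewrite wdiff_lin; last exact: recast_linear.
  by apply: wdiff_ext => v _; rewrite recast_B // addrK.
have -> : recast (lin_ext (contract true (B 1 n (d - 1 + 1))) (wdiff (B 1 n (d - 1)) w)) =
    wdiff (contract true (B 1 n d)) w :> Tw K n d.
  rewrite wdiff_lin; last exact: lin_ext_is_linear.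
  rewrite wdiff_lin; last exact: recast_linear.
  apply: wdiff_ext => u wu; rewrite lin_ext_B //; last exact: bideg_wstep1 okw wu.
  rewrite contract_lin; last exact: recast_linear.
  congr contract; apply: functional_extensionality_dep => v.
  by rewrite recast_B // subrK.
rewrite addrC contract_homotopy //.
by case: ifP => _; rewrite ?subrr ?subr0.
Qed.

End TwHomotopy.

(** * Maps onto homology that admit a retraction *)

Section Boundaries.
Variables (K : fieldType) (P : ns_operad K).
Variable D : forall n d, {linear P n d -> P n (d - 1)}.
Hypothesis derivD : is_derivation D.
Hypothesis ocomp_linl : forall m n p q i (y : P n q), (i < m)%N ->
  linear (fun x : P m p => ocomp i x y).
Hypothesis ocomp_linr : forall m n p q i (x : P m p), (i < m)%N ->
  linear (fun y : P n q => ocomp i x y).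

(** The transport of degrees is the one in [boundaries]. *)
Definition boundary n d (x : P n d) : Prop :=
  exists y : P n (d + 1), recast (D n (d + 1) y) = x.

Lemma boundary_lin n d a (x y : P n d) :
  boundary x -> boundary y -> boundary (a *: x + y).
Proof.
move=> [u <-] [v <-]; exists (a *: u + v).
by rewrite linearP recastP.
Qed.

Lemma boundary_image (V : lmodType K) n d (g : {linear V -> P n d}) a x y :
  boundary (g x) -> boundary (g y) -> boundary (g (a *: x + y)).
Proof. by rewrite linearP; exact: boundary_lin. Qed.

Lemma boundary0 n d : boundary (0 : P n d).
Proof. by exists 0; rewrite linear0 recast0. Qed.

Lemma boundaryZ n d a (x : P n d) : boundary x -> boundary (a *: x).
Proof. by move=> bx; rewrite -[_ *: _]addr0; apply: boundary_lin => //; exact: boundary0. Qed.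

Lemma recast_ocomp_recast m n p q m' n' p' q' r s i
    (x : P m p) (y : P n q) : m = m' -> p = p' -> n = n' -> q = q' ->
  recast (ocomp i (recast x : P m' p') (recast y : P n' q')) =
  recast (ocomp i x y) :> P r s.
Proof. by move=> *; subst; rewrite !recast_id. Qed.

Lemma recast_D m n p q (x : P m p) : m = n -> p = q ->
  D n q (recast x) = recast (D m p x).
Proof. by move=> em ep; subst; rewrite !recast_id. Qed.

Lemma cycle_ocomp m n p q i (x : P m p) (y : P n q) : (i < m)%N ->
  D _ _ x = 0 -> D _ _ y = 0 -> D _ _ (ocomp i x y) = 0.
Proof.
move=> lti Dx Dy; rewrite derivD.1 // Dx Dy.
rewrite (linear_for0 (ocomp_linl _ lti)) (linear_for0 (ocomp_linr _ lti)).
by rewrite !recast0 scaler0 addr0.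
Qed.

(** With [boundary_ocompr]: boundaries form an ideal in the cycles, by the
    derivation rule. *)
Lemma boundary_ocompl m n p q i (x : P m p) (z : P n q) : (i < m)%N ->
  boundary x -> D _ _ z = 0 -> boundary (ocomp i x z).
Proof.
move=> lti [y <-] Dz; exists (recast (ocomp i y z)).
rewrite recast_D //; last by lia.
rewrite derivD.1 // Dz (linear_for0 (ocomp_linr _ lti)).
rewrite recast0 scaler0 addr0 !recast_trans //; try lia.
rewrite -[RHS]recast_id -[z in RHS]recast_id.
by rewrite recast_ocomp_recast //; lia.
Qed.

Lemma boundary_ocompr m n p q i (x : P m p) (z : P n q) : (i < m)%N ->
  D _ _ x = 0 -> boundary z -> boundary (ocomp i x z).
Proof.
move=> lti Dx [y <-]; rewrite -[ocomp _ _ _]scale1r.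
have -> : 1 = (-1) ^+ `|p| * (-1) ^+ `|p| :> K.
  by rewrite -exprD addnn -mul2n exprM sqrrN !expr1n.
rewrite -scalerA; apply: boundaryZ; exists (recast (ocomp i x y)).
rewrite recast_D //; last by lia.
rewrite derivD.1 // Dx (linear_for0 (ocomp_linl _ lti)) recast0 add0r.
rewrite recast_trans //; last by lia.
rewrite linearZ /=; congr (_ *: _); rewrite recast_trans //; last by lia.
rewrite -[RHS]recast_id -[x in RHS]recast_id.
by rewrite recast_ocomp_recast //; lia.
Qed.

Definition to_cycle n d (x : P n d) : sub_operad (cycles D) n d := insubd 0 x.

Lemma val_to_cycle n d (x : P n d) : D n d x = 0 -> val (to_cycle x) = x.
Proof. by move=> Dx; apply: insubdK; exact/eqP. Qed.

Lemma cycleP n d (z : sub_operad (cycles D) n d) : D n d (val z) = 0.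
Proof. by apply/eqP; exact: (valP z). Qed.

Lemma hclass_eq n d (x y : P n d) : D _ _ x = 0 -> D _ _ y = 0 ->
  hclass D x = hclass D y <-> boundary (x - y).
Proof.
move=> Dx Dy; have e : val (to_cycle x - to_cycle y) = x - y.
  by rewrite -[LHS]/(val (to_cycle x) - val (to_cycle y)) !val_to_cycle.
have bE z : (z \in smem (boundaries D n d)) = `[< boundary (val z) >] by [].
rewrite -e; split; first by move/eqP; rewrite /hclass quotpiE bE => /asboolP.
by move=> b; apply/eqP; rewrite /hclass quotpiE bE; apply/asboolP.
Qed.

Lemma hclass_val n d (z : sub_operad (cycles D) n d) :
  hclass D (val z) = quotpi (boundaries D n d) z.
Proof. by rewrite /hclass valKd. Qed.

Lemma hclass_linear n d a (x y : P n d) : D n d x = 0 -> D n d y = 0 ->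
  hclass D (a *: x + y) = a *: hclass D x + hclass D y.
Proof.
move=> Dx Dy; have Dxy : D n d (a *: x + y) = 0.
  by rewrite linearP Dx Dy scaler0 addr0.
have e : to_cycle (a *: x + y) = a *: to_cycle x + to_cycle y.
  apply: val_inj; rewrite (val_to_cycle Dxy).
  by rewrite -[RHS]/(a *: val (to_cycle x) + val (to_cycle y)) !val_to_cycle.
rewrite -[LHS]/(quotpi (boundaries D n d) (to_cycle (a *: x + y))) e.
exact: quotpi_is_linear.
Qed.

(** Composites in homology are defined on chosen representatives; this makes them
    available on any. *)
Lemma hclass_ocomp m n p q i (x : P m p) (y : P n q) : (i < m)%N ->
  D _ _ x = 0 -> D _ _ y = 0 ->
  ocomp i (hclass D x) (hclass D y) = hclass D (ocomp i x y).
Proof.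
move=> lti Dx Dy.
set u := quotrepr (hclass D x); set v := quotrepr (hclass D y).
have Du := cycleP u; have Dv := cycleP v.
have bu : boundary (val u - x).
  by apply/hclass_eq => //; rewrite hclass_val quotreprK.
have bv : boundary (val v - y).
  by apply/hclass_eq => //; rewrite hclass_val quotreprK.
rewrite -[LHS]/(hclass D (ocomp i (val u) (val v))).
apply/hclass_eq; [exact: cycle_ocomp | exact: cycle_ocomp |].
have -> : ocomp i (val u) (val v) - ocomp i x y =
    1 *: ocomp i (val u - x) (val v) + ocomp i x (val v - y).
  rewrite scale1r -scaleN1r.
  have -> : val u - x = (-1) *: x + val u by rewrite scaleN1r addrC.
  have -> : val v - y = (-1) *: y + val v by rewrite scaleN1r addrC.
  rewrite (ocomp_linl (val v) lti) (ocomp_linr x lti) !scaleN1r.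
  by rewrite [- _ + ocomp _ (val u) _]addrC [- _ + ocomp _ _ (val v)]addrC subrKA.
apply: boundary_lin; first exact: boundary_ocompl.
exact: boundary_ocompr.
Qed.
End Boundaries.

(** Let [f] map [R] to cycles and an ideal [I] to boundaries, and let [r] be a linear
    retraction that kills boundaries, with [f o r] homotopic to the identity on
    cycles and [r o f] congruent to the identity modulo [I].  Then [f] induces an
    isomorphism from [R / I] to homology; its inverse is continuous as soon as [r]
    kills some term of the filtration. *)
Section QuotientHomology.
Variables (K : fieldType) (P R : ns_operad K).
Variable D : forall n d, {linear P n d -> P n (d - 1)}.
Hypothesis derivD : is_derivation D.
Hypothesis ocomp_linl : forall m n p q i (y : P n q), (i < m)%N ->
  linear (fun x : P m p => ocomp i x y).
Hypothesis ocomp_linr : forall m n p q i (x : P m p), (i < m)%N ->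
  linear (fun y : P n q => ocomp i x y).
Variable I : forall n d, submodule (R n d).
Variable f : forall n d, {linear R n d -> P n d}.
Hypothesis f_morph : is_morphism f.
Hypothesis f_cycle : forall n d x, D n d (f n d x) = 0.
Hypothesis f_ideal : forall n d x, x \in smem (I n d) -> boundary D (f n d x).
Variable r : forall n d, P n d -> R n d.
Hypothesis r_linear : forall n d, linear (@r n d).
Hypothesis r_boundary : forall n d x, boundary D x -> @r n d x = 0.
Hypothesis fr : forall n d x, D n d x = 0 -> boundary D (x - f n d (r x)).
Hypothesis rf : forall n d x, r (f n d x) - x \in smem (I n d).
Variable q0 : nat.
Hypothesis r_filt : forall n d x, ofilt q0 x -> @r n d x = 0.
Hypothesis filt0 : forall p n d, ofilt p (0 : R n d).

Definition homology_map n d (x : quot_operad I n d) : homology D n d :=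
  hclass D (f n d (quotrepr x)).

Lemma homology_map_pi n d (x : R n d) :
  homology_map (quotpi (I n d) x) = hclass D (f n d x).
Proof.
apply/hclass_eq => //; rewrite -linearB; apply: f_ideal.
by rewrite -quotpiE quotreprK.
Qed.

Lemma homology_map_linear n d : linear (@homology_map n d).
Proof.
move=> a x y; rewrite -[x]quotreprK -[y]quotreprK -quotpi_is_linear.
by rewrite !homology_map_pi linearP hclass_linear.
Qed.

HB.instance Definition _ n d :=
  GRing.isLinear.Build K (quot_operad I n d) (homology D n d) *:%R (@homology_map n d)
    (@homology_map_linear n d).

Definition induced n d : {linear quot_operad I n d -> homology D n d} :=
  @homology_map n d.

(** The retraction of a chosen representative cycle; any other cycle in the class
    gives the same value ([homology_inv_hclass]). *)
Definition homology_inv n d (c : homology D n d) : quot_operad I n d :=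
  quotpi (I n d) (r (val (quotrepr c))).

Lemma homology_inv_hclass n d (x : P n d) : D n d x = 0 ->
  homology_inv (hclass D x) = quotpi (I n d) (r x).
Proof.
move=> Dx; congr quotpi; set z := quotrepr _.
have b : boundary D (val z - x).
  by apply/hclass_eq; rewrite ?cycleP // hclass_val quotreprK.
have := r_boundary b; rewrite addrC -scaleN1r r_linear scaleN1r addrC.
by move/eqP; rewrite subr_eq0 => /eqP.
Qed.

Lemma homology_invK n d (x : quot_operad I n d) : homology_inv (homology_map x) = x.
Proof.
rewrite -[x]quotreprK homology_map_pi homology_inv_hclass //.
by apply/eqP; rewrite quotpiE.
Qed.

Lemma homology_mapK n d (c : homology D n d) : homology_map (homology_inv c) = c.
Proof.
rewrite -[c]quotreprK -hclass_val; set z := quotrepr c.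
have Dz := cycleP z; rewrite homology_inv_hclass // homology_map_pi.
by apply/esym/hclass_eq => //; exact: fr.
Qed.

Lemma induced_isomorphism : is_isomorphism induced.
Proof.
have [f1 fM fF] := f_morph; split.
- split.
  + by rewrite [LHS]homology_map_pi f1.
  + move=> m n p q i x y lti; rewrite [LHS]homology_map_pi fM //.
    by rewrite -hclass_ocomp.
  + move=> p n d _ [y py <-]; exists (to_cycle D (f n d y)) => /=.
      by rewrite val_to_cycle //; exact: fF.
    by rewrite [RHS]homology_map_pi.
- by move=> n d; exists (@homology_inv n d); [exact: homology_invK | exact: homology_mapK].
move=> p; exists q0 => n d x [z z0 ez]; exists 0; first exact: filt0.
rewrite -[x]homology_invK -[homology_map x]/(induced n d x) -ez -hclass_val.
by rewrite homology_inv_hclass ?cycleP // r_filt.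
Qed.

End QuotientHomology.

(** * The ideal and the homology *)

Section Retraction.
Variable K : fieldType.
Local Notation B := (wbasis K).
Local Notation Bs := (conn_basis K).
Local Notation G := (shAs_gamma K).
Local Notation boundary := (boundary (twD K)).

(** The retraction is the linear projection onto the surviving words, with [a s a]
    read as [gamma]. *)
Definition retract_word n d (w : seq letter) : G n d :=
  if all (pred1 inp) w then Bs n d w
  else if w == [:: blk; gap; blk] then Bs n d [:: blk] else 0.

Definition retract n d (x : Tw K n d) : G n d := lin_ext (retract_word n d) x.

Lemma retract_linear n d : linear (@retract n d).
Proof. exact: lin_ext_is_linear. Qed.

Lemma retract_B n d w : bideg 1 n d w -> retract (B 1 n d w) = retract_word n d w.
Proof. by move=> okw; rewrite /retract lin_ext_B. Qed.

Lemma all_inp_num w : all (pred1 inp) w -> num_blk w = 0%N /\ num_gap w = 0%N.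
Proof.
rewrite /num_blk /num_gap; elim: w => [//|l w IH] /= /andP[/eqP-> /IH[-> ->]].
by [].
Qed.

Lemma double_blk_id w : num_blk w = 0%N -> double_blk w = w.
Proof.
rewrite /num_blk /double_blk; elim: w => [//|l w IH] /=.
by case: l => [[]|] //= /IH ->.
Qed.

Lemma bideg_all_inp n d w : bideg 1 n d w -> all (pred1 inp) w -> conn_bideg n d w.
Proof.
move=> okw /all_inp_num[b0 g0]; rewrite /conn_bideg g0 andbT.
case/and3P: okw => vw nw dw; apply/and3P; split=> //.
by move: dw; rewrite b0 !mul0n.
Qed.

Lemma phi_retract n d (x : Tw K n d) :
  phi K n d (retract x) = lin_ext (fun w => if representative true w then B 1 n d w else 0) x.
Proof.
move: x; apply: Q_linear_ext => //.
- exact: (linear_for_comp (@phi_linear K n d) (@retract_linear n d)).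
- exact: lin_ext_is_linear.
move=> w okw; rewrite retract_B // lin_ext_B // /retract_word /representative /=.
case: ifP => [aw|_] /=.
  have [b0 _] := all_inp_num aw.
  by rewrite phi_Bs ?double_blk_id //; exact: bideg_all_inp.
case: eqP => [ew|_]; last exact: linear_for0 (@phi_linear K n d).
rewrite phi_Bs ?ew // /conn_bideg andbT; rewrite ew in okw.
case/and3P: okw => _ /eqP <- /eqP dw.
by apply/and3P; split=> //; apply/eqP; move: dw; rewrite /num_inp /num_blk /num_gap /=; lia.
Qed.

(** The homotopy identity applied to a cycle. *)
Lemma cycle_homotopy n d (x : Tw K n d) : twD K n d x = 0 ->
  boundary (x - phi K n d (retract x)).
Proof.
move=> Dx; exists (tw_contract x).
rewrite phi_retract -tw_homotopy Dx.
have -> : tw_contract (0 : Tw K n (d - 1)) = 0.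
  exact: (linear_for0 (@tw_contract_linear K n (d - 1))).
by rewrite recast0 addr0.
Qed.

(** A word in the differential of a valid word contains [a], and it is not [a s a]:
    removing one [a] from it leaves a gap at one end. *)
Lemma retract_boundary n d (x : Tw K n d) : boundary x -> retract x = 0.
Proof.
case=> y <-; move: y.
apply: (@Q_linear_ext K 1 n (d + 1) _
  (fun y => retract (recast (twD K n (d + 1) y))) (fun=> 0)) => //.
- apply: (linear_for_comp (@retract_linear n d)).
  by apply: linear_for_comp; [exact: recast_linear | exact: linear_twD].
- by move=> a x' y; rewrite scaler0 addr0.
move=> w okw; rewrite twD_B // wdiff_lin; last exact: recast_linear.
rewrite wdiff_lin; last exact: retract_linear.
rewrite -[RHS](wdiff0 (G n d) w); apply: wdiff_ext => u wu.
have oku : bideg 1 n d u by have := bideg_wstep1 okw wu; rewrite addrK.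
rewrite recast_B ?addrK // retract_B // /retract_word.
have [_ bu gu su] := wstepP wu.
case: ifP => [/all_inp_num[]|_]; first by rewrite bu.
case: eqP => // eu; move: bu gu su; rewrite eu /num_blk /num_gap /= => [[bw] gw [sw]].
case/and3P: okw => vw _ _.
by case: w {wu} vw bw gw sw => [|[b|] [|[c|] [|? ?]]].
Qed.

End Retraction.

Section Ideal.
Variable K : fieldType.
Local Notation Bs := (conn_basis K).
Local Notation G := (shAs_gamma K).
Local Notation boundary := (boundary (twD K)).

Lemma Tw_ocompPl m n p q i (y : Tw K n q) : (i < m)%N ->
  linear (fun x : Tw K m p => ocomp i x y).
Proof. by move=> _; exact: ocompPl. Qed.

Lemma Tw_ocompPr m n p q i (x : Tw K m p) : (i < m)%N ->
  linear (fun y : Tw K n q => ocomp i x y).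
Proof. by move=> _; exact: ocompPr. Qed.

Lemma twD_derivation : is_derivation (twD K).
Proof. by have [] := twD_is_twisting K. Qed.

(** The part of [shAs_gamma] that vanishes in homology.  That it is an ideal
    containing the relations puts the generated ideal inside it. *)
Definition phi_kernel n d : {pred G n d} := fun x => `[< boundary (phi K n d x) >].

Lemma phi_kernelP n d (x : G n d) :
  reflect (boundary (phi K n d x)) (x \in @phi_kernel n d).
Proof. exact: asboolP. Qed.

Lemma retract_double n d w : conn_bideg n d w -> (0 < num_blk w)%N -> (1 < size w)%N ->
  retract_word K n d (double_blk w) = 0.
Proof.
move=> okw bw sw; have [_ bd _ sd] := num_double_blk w.
rewrite /retract_word; case: ifP => [/all_inp_num[]|_]; first by rewrite bd; lia.
by case: eqP => // e; move: sd; rewrite e /=; lia.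
Qed.

(** The image is a word whose retraction vanishes, so it is a boundary by
    [cycle_homotopy]. *)
Lemma phi_null n d w : conn_bideg n d w -> (0 < num_blk w)%N -> (1 < size w)%N ->
  boundary (phi K n d (Bs n d w)).
Proof.
move=> okw bw sw; have := cycle_homotopy (phi_cycle (Bs n d w)).
rewrite {2}phi_Bs // retract_B ?retract_double //; last exact: double_blk_bideg.
by rewrite (linear_for0 (@phi_linear K n d)) subr0.
Qed.

Lemma edge_gamma_l : ocomp 0 (shAs_gamma_edge K) (gamma K) = Bs 1 (-3) [:: blk; inp].
Proof.
rewrite edge_Bs gamma_Bs (@comp_Bs K 2 0 1 (- 4%:Z) 0 [::] [:: inp] [:: blk]) //.
by rewrite muln0 scale1r.
Qed.

Lemma edge_gamma_r : ocomp 1 (shAs_gamma_edge K) (gamma K) = Bs 1 (-3) [:: inp; blk].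
Proof.
rewrite edge_Bs gamma_Bs (@comp_Bs K 2 0 1 (- 4%:Z) 1 [:: inp] [::] [:: blk]) //.
by rewrite muln0 scale1r.
Qed.

(** Cycles times boundaries are boundaries.  Topological closure costs nothing, as
    the filtration is finite in each bidegree. *)
Lemma phi_kernel_ideal : is_ideal phi_kernel.
Proof.
split.
- move=> n d; split.
    by apply/phi_kernelP; rewrite (linear_for0 (@phi_linear K n d)); exact: boundary0.
  move=> a x y /phi_kernelP bx /phi_kernelP by_; apply/phi_kernelP.
  exact: (boundary_image (g := phi K n d) a bx by_).
- move=> m n p q i x y lti /phi_kernelP bx; apply/phi_kernelP; rewrite phi_ocomp //.
  apply: (boundary_ocompl twD_derivation Tw_ocompPr) => //; exact: phi_cycle.
- move=> m n p q i x y lti /phi_kernelP bx; apply/phi_kernelP; rewrite phi_ocomp //.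
  apply: (boundary_ocompr twD_derivation Tw_ocompPl) => //; exact: phi_cycle.
move=> n d x xJ; have [y Jy] := xJ (n + `|d|).+1.
move/emb_ofilt/ofilt_large => /(_ isT (ltnSn _)) xy.
suff -> : x = y by [].
apply/eqP; rewrite -subr_eq0; apply/eqP; apply: emb_inj.
by rewrite xy (linear_for0 (@emb_linear K n d)).
Qed.

Lemma phi_ideal n d (x : G n d) : x \in smem (shAs_plus_ideal K n d) ->
  boundary (phi K n d x).
Proof.
move/asboolP => /(_ phi_kernel phi_kernel_ideal) H; apply/phi_kernelP; apply: H.
move=> n' d' y [].
  by rewrite edge_gamma_l; apply/phi_kernelP; apply: phi_null.
by rewrite edge_gamma_r; apply/phi_kernelP; apply: phi_null.
Qed.

Lemma valid_gapless w : w != [::] -> num_gap w = 0%N -> valid w.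
Proof.
have pw b u : num_gap u = 0%N -> path no_two_gaps (Some b) (rcons u gap).
  by rewrite /num_gap; elim: u b => [//|[c|] u IH] b //= /IH; apply.
by case: w => [//|[b|] w] //= _ gw; rewrite /valid /= pw.
Qed.

Lemma conn_bideg_ungraft n d n2 d2 w0 p w1 :
  conn_bideg n d (w0 ++ p ++ w1) -> conn_bideg n2 d2 p ->
  conn_bideg (num_inp w0 + num_inp w1).+1 (d - d2) (w0 ++ inp :: w1) /\
  ((num_inp w0 + num_inp w1).+1 + n2).-1 = n.
Proof.
case/andP=> /and3P[_ /eqP nw /eqP dw] /eqP gw /andP[/and3P[_ /eqP np /eqP dp] /eqP gp].
have g0 : num_gap (w0 ++ inp :: w1) = 0%N.
  by move: gw; rewrite /num_gap !count_cat /=; lia.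
split; last by move: nw np; rewrite /num_inp !count_cat /=; lia.
rewrite /conn_bideg g0 andbT; apply/and3P; split.
- by apply: valid_gapless => //; case: (w0).
- by rewrite /num_inp count_cat /=; apply/eqP; lia.
move: dw dp gw gp g0; rewrite /num_inp /num_blk /num_gap !count_cat /= => *.
by apply/eqP; lia.
Qed.

(** In a longer word a letter [gamma] has a neighbour.  The subword formed by the
    two of them is [b(gamma, -)], [b(-, gamma)] or [b(gamma, gamma)], the latter
    being a composite of the first; the word is obtained by plugging it into a
    shorter one. *)
Lemma plugged_in_ideal (I : forall n d, {pred G n d}) n d w :
  is_ideal I -> (forall n' d' (y : G n' d'), shAs_plus_relation y -> y \in I _ _) ->
  conn_bideg n d w -> (0 < num_blk w)%N -> (1 < size w)%N -> Bs n d w \in I n d.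
Proof.
move=> [cI lI rI _] relI okw bw sw.
have IAX : Bs 1 (-3) [:: blk; inp] \in I 1 (-3).
  by rewrite -edge_gamma_l; apply: relI; exact: EdgeGammaL.
have IXA : Bs 1 (-3) [:: inp; blk] \in I 1 (-3).
  by rewrite -edge_gamma_r; apply: relI; exact: EdgeGammaR.
have IAA : Bs 0 (-7) [:: blk; blk] \in I 0 (-7).
  have := @lI 1 0 (-3) (- 4%:Z) 0 _ (gamma K) isT IAX.
  rewrite gamma_Bs (@comp_Bs K 1 0 (-3) (- 4%:Z) 0 [:: blk] [::] [:: blk]) //.
  by rewrite muln0 scale1r.
have [w0 [p [w1 [ew [n2 [d2 [okp Ip]]]]]]] : exists w0 p w1, w = w0 ++ p ++ w1 /\
    exists n2 d2, conn_bideg n2 d2 p /\ Bs n2 d2 p \in I n2 d2.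
  have gw : num_gap w = 0%N by case/andP: okw => _ /eqP.
  have [u0 [u1 ew]] := blk_split bw; subst w.
  case: u1 gw sw {okw bw} => [|l u1] gw sw.
    case/lastP: u0 gw sw => [//|u0 l] gw _.
    exists u0, [:: l; blk], [::]; rewrite cat_rcons; split=> //.
    case: l gw => [[]|] gw; [by exists 0%N, (-7) | by exists 1%N, (-3) |].
    by move: gw; rewrite /num_gap -cats1 !count_cat /=; lia.
  exists u0, [:: blk; l], u1; split=> //.
  case: l gw {sw} => [[]|] gw; [by exists 0%N, (-7) | by exists 1%N, (-3) |].
  by move: gw; rewrite /num_gap !count_cat /=; lia.
subst w; have [okm en] := conn_bideg_ungraft okw okp.
have lti : (num_inp w0 < (num_inp w0 + num_inp w1).+1)%N by lia.
have := rI _ _ _ _ (num_inp w0)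
  (Bs (num_inp w0 + num_inp w1).+1 (d - d2) (w0 ++ inp :: w1)) _ lti Ip.
rewrite (comp_Bs K okm okp) //; set s := (-1) ^+ _.
have tr r e : r = n -> e = d -> s *: Bs r e (w0 ++ p ++ w1) \in I r e ->
    Bs n d (w0 ++ p ++ w1) \in I n d.
  move=> er ee; subst r e => Is; have [I0 IP] := cI n d.
  have ss : s * s = 1 by rewrite -exprD addnn -mul2n exprM sqrrN !expr1n.
  have -> : Bs n d (w0 ++ p ++ w1) = s *: (s *: Bs n d (w0 ++ p ++ w1)) + 0.
    by rewrite scalerA ss scale1r addr0.
  exact: IP.
by apply: tr => //; rewrite subrK.
Qed.

(** Words with no letter [gamma] and the word [gamma] are fixed; all the other words
    are sent to 0, and lie in the ideal. *)
Lemma retract_phi n d (x : G n d) :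
  quotpi (shAs_plus_ideal K n d) (retract (phi K n d x)) = quotpi _ x.
Proof.
move: x; apply: G_linear_ext.
- apply: (linear_for_comp (@quotpi_is_linear K _ (shAs_plus_ideal K n d))).
  by apply: linear_for_comp; [exact: retract_linear | exact: phi_linear].
- exact: quotpi_is_linear.
move=> w okw; rewrite phi_Bs // retract_B; last exact: double_blk_bideg.
have [bw|bw] := posnP (num_blk w).
  rewrite double_blk_id // /retract_word ifT //.
  case/andP: okw => _ /eqP gw; rewrite (all_inp bw gw).
  by elim: (num_inp w) => //= k ->.
have [sw|sw] := ltnP 1 (size w).
  rewrite retract_double //; apply/eqP; rewrite quotpiE sub0r rpredN.
  by apply/asboolP => I iI relI; exact: plugged_in_ideal.
by case: w okw bw sw => [|[[]|] [|? ?]].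
Qed.

End Ideal.

(** The surviving words have at most two black vertices. *)
Lemma retract_filt (K : fieldType) n d (x : Tw K n d) : ofilt 3 x -> retract x = 0.
Proof.
apply: (lin_ext_filt (F := fun y => y = 0)) => //.
- by move=> a u v -> ->; rewrite scaler0 addr0.
move=> w okw w3; rewrite /retract_word; case: ifP => [/all_inp_num[w0]|_].
  by rewrite w0 in w3.
by case: eqP => // ew; rewrite ew in w3.
Qed.

Lemma retract_phi_ideal (K : fieldType) n d (x : shAs_gamma K n d) :
  retract (phi K n d x) - x \in smem (shAs_plus_ideal K n d).
Proof. by rewrite -quotpiE retract_phi. Qed.

Theorem theorem6p2 (K : fieldType) :
  exists D : forall n d, {linear Tw K n d -> Tw K n (d - 1)},
  [/\ is_twisting_differential D,
      forall D' : forall n d, {linear Tw K n d -> Tw K n (d - 1)},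
        is_twisting_differential D' -> forall n d x, D' n d x = D n d x &
      exists phi : forall n d, {linear shAs_gamma K n d -> Tw K n d},
      [/\ is_comparison D phi,
          forall phi' : forall n d, {linear shAs_gamma K n d -> Tw K n d},
            is_comparison D phi' -> forall n d x, phi' n d x = phi n d x &
          exists Phi : forall n d, {linear shAs_plus K n d -> homology D n d},
            is_isomorphism Phi /\
            forall n d (x : shAs_gamma K n d),
              Phi n d (quotpi (@shAs_plus_ideal K n d) x) = hclass D (phi n d x)]].
Proof.
exists (twD K); split; [exact: twD_is_twisting | exact: twD_unique |].
exists (phi K); split; [exact: phi_comparison | exact: phi_unique |].
exists (induced (@phi_cycle K) (@phi_ideal K)); split.
  apply: (@induced_isomorphism K _ _ _ (@twD_derivation K) (@Tw_ocompPl K)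
    (@Tw_ocompPr K) _ _ (comparison_morph (phi_comparison K)) _ _
    (@retract K) (@retract_linear K) (@retract_boundary K) (@cycle_homotopy K)
    (@retract_phi_ideal K) 3 (@retract_filt K)).
  move=> p n d; apply/emb_ofilt; rewrite (linear_for0 (@emb_linear K n d)).
  exact: ofilt0.
by move=> n d x; exact: (homology_map_pi (@phi_cycle K) (@phi_ideal K)).
Qed.
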